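(* Let $\lambda\in\mathbb{R}_+=[0,\infty)$ and let $(\mathrm{w}_t)_{t\ge 0}$, $(\mathrm{m}_{\lambda,t})_{t\ge 0}$, $(\mathrm{w}_{\lambda,t})_{t\ge 0}$ be the measure-valued processes defined in the context. (i) Given the Cauchy transform $G_{\mathrm{w}_0}(z)$ of the initial measure $\mathrm{w}_0\in\mathcal{P}^0(\mathbb{R})$, the solution of $$\frac{\partial G_{\mathrm{w}_t}(z)}{\partial t}+G_{\mathrm{w}_t}(z)\frac{\partial G_{\mathrm{w}_t}(z)}{\partial z}=0,\qquad t\ge0,$$ satisfies the functional equation $$G_{\mathrm{w}_t}(z)=G_{\mathrm{w}_0}\big(z-tG_{\mathrm{w}_t}(z)\big),\qquad t\ge0.$$ (ii) Given the Cauchy transform $G_{\mathrm{m}_{\lambda,0}}(z)$ of the initial measure $\mathrm{m}_{\lambda,0}\in\mathcal{P}^0(\mathbb{R}_+)$, the solution of $$\frac{\partial G_{\mathrm{m}_{\lambda,t}}(z)}{\partial t}+\{2zG_{\mathrm{m}_{\lambda,t}}(z)-(1-\lambda)\}\frac{\partial G_{\mathrm{m}_{\lambda,t}}(z)}{\partial z}+G_{\mathrm{m}_{\lambda,t}}(z)^2=0,\qquad t\ge0,$$ satisfies the functional equation $$\frac{1}{G_{\mathrm{m}_{\lambda,t}}(z)}=t+\frac{1}{G_{\mathrm{m}_{\lambda,0}}\Big(\big(1-tG_{\mathrm{m}_{\lambda,t}}(z)\big)\big\{(1-\lambda)t+\big(1-tG_{\mathrm{m}_{\lambda,t}}(z)\big)z\big\}\Big)},\qquad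 t\ge0.$$ (iii) Given the Cauchy transform $G_{\mathrm{w}_{\lambda,0}}(z)$ of the initial measure $\mathrm{w}_{\lambda,0}\in\mathcal{P}^0_{\mathrm{s}}(\mathbb{R})$, the solution of $$\frac{\partial G_{\mathrm{w}_{\lambda,t}}(z)}{\partial t}+\Big(G_{\mathrm{w}_{\lambda,t}}(z)-\frac{1-\lambda}{2z}\Big)\frac{\partial G_{\mathrm{w}_{\lambda,t}}(z)}{\partial z}+\frac{1-\lambda}{2z^2}G_{\mathrm{w}_{\lambda,t}}(z)=0,\qquad t\ge0,$$ satisfies the functional equation $$\frac{1}{G_{\mathrm{w}_{\lambda,t}}(z)}=\frac tz+\frac{\sqrt{\big(1-\frac tzG_{\mathrm{w}_{\lambda,t}}(z)\big)\big\{(1-\lambda)t+\big(1-\frac tzG_{\mathrm{w}_{\lambda,t}}(z)\big)z^2\big\}}}{z\,G_{\mathrm{w}_{\lambda,0}}\Big(\sqrt{\big(1-\frac tzG_{\mathrm{w}_{\lambda,t}}(z)\big)\big\{(1-\lambda)t+\big(1-\frac tzG_{\mathrm{w}_{\lambda,t}}(z)\big)z^2\big\}}\Big)},\qquad t\ge0.$$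
   Context: For $S=\mathbb{R}$ or $\mathbb{R}_+=[0,\infty)$, $\mathcal{P}^0(S)$ is the set of Borel probability measures on $S$ with bounded support, equipped with the weak topology; $\mathcal{P}^0_{\mathrm{s}}(\mathbb{R})$ is the set of symmetric elements of $\mathcal{P}^0(\mathbb{R})$, i.e. those with $\mu(B)=\mu(-B)$ for all Borel $B\subset(0,\infty)$. The Cauchy transform of $\mu\in\mathcal{P}^0(S)$ is $G_\mu(z)=\int_S\frac{\mu(dx)}{z-x}$, $z\in\mathbb{C}^+=\{z\in\mathbb{C}:\operatorname{Im}z>0\}$. $(\mathrm{w}_t)_{t\ge0}$, $(\mathrm{m}_{\lambda,t})_{t\ge0}$, $(\mathrm{w}_{\lambda,t})_{t\ge0}$ are continuous processes in $t\in[0,\infty)$ with values in $\mathcal{P}^0(\mathbb{R})$, $\mathcal{P}^0(\mathbb{R}_+)$, $\mathcal{P}^0_{\mathrm{s}}(\mathbb{R})$ respectively, defined so that their Cauchy transforms solve the respective PDEs displayed in (i), (ii), (iii), with initial data the Cauchy transforms of the given initial measures. In these PDEs, $t\in[0,\infty)$ and $z\in\mathbb{C}^+$ are the independent variables. The processes are related by $\mathrm{m}_{\lambda,t}=\mathrm{w}_{\lambda,t}^{(2)}$ for all $t\ge 0$, provided that $\mathrm{m}_{\lambda,0}=\mathrm{w}_{\lambda,0}^{(2)}$, where $\mu^{(2)}$ denotes the push-forward of $\mu$ under $x\mapsto|x|^2$. *)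

(* Defs.v *)
From HB Require Import structures.
From mathcomp Require Import all_boot all_order all_algebra.
From mathcomp Require Import all_classical all_reals all_analysis.
From mathcomp Require Import complex.

Set Implicit Arguments.
Unset Strict Implicit.
Unset Printing Implicit Defensive.

Import Order.TTheory GRing.Theory Num.Theory.
Import numFieldNormedType.Exports.

Local Open Scope classical_set_scope.
Local Open Scope ring_scope.
Local Open Scope complex_scope.

(* [R[i]] packed as a numClosedFieldType: going through the structure makes
   the topology that MathComp-Analysis puts on every numFieldType available,
   which is not inferred from the bare carrier [complex R]. *)
Definition cplx (R : realType) : numClosedFieldType := R[i].

Definition toC (R : realType) (x : R) : cplx R := x%:C.

Definition upper_half_plane (R : realType) : set (cplx R) :=
  [set z | 0 < complex.Im z].

Definition bprob (R : realType) := probability (measurableTypeR R) R.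

Definition msupport (R : realType) (mu : bprob R) : set R :=
  [set x | forall U : set R, open U -> U x -> (0%E < mu U)%E].

(* [S] is R or R_+; a Borel probability measure on [S] is identified with a
   Borel probability measure on R giving no mass to the complement of [S]. *)
Definition P0 (R : realType) (S : set R) : set (bprob R) :=
  [set mu : bprob R | mu (~` S) = 0%E /\ bounded_set (msupport mu)].

Definition P0_sym (R : realType) : set (bprob R) :=
  [set mu : bprob R | P0 setT mu /\
    forall B : set (measurableTypeR R), measurable B -> B `<=` `]0, +oo[ ->
      mu B = mu [set - x | x in B]].

(* Only the values at times t >= 0 are meaningful; continuity is with respect
   to the weak topology (test functions are bounded and continuous). *)
Definition weakly_continuous_process (R : realType) (E : set (bprob R))
    (w : R -> bprob R) : Prop :=
  (forall t : R, 0 <= t -> E (w t)) /\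
  (forall f : R -> R, continuous f -> bounded_fun f ->
     {within `[0, +oo[, continuous (fun t : R => \int[w t]_x f x)%R}).

Definition cauchy_transform (R : realType) (mu : bprob R) (z : cplx R) : cplx R :=
  (\int[mu]_x complex.Re ((z - toC x)^-1))%R +i*
  (\int[mu]_x complex.Im ((z - toC x)^-1))%R.

(* [l] is the derivative at [t] of [f : [0, +oo[ -> C]; it is one-sided at
   [t = 0]. *)
Definition is_time_derive (R : realType) (f : R -> cplx R) (t : R)
    (l : cplx R) : Prop :=
  (f (t + h) - f t) / toC h @[h --> within [set h | 0 <= t + h] 0^'] --> l.

(* [sqrtC] is the square root with nonnegative imaginary part (nonnegative real
   on R_+), hence the branch mapping C \ R_+ onto the upper half-plane, where
   Cauchy transforms are evaluated; it is not the principal branch. *)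
Definition sqrt_up (R : realType) (z : cplx R) : cplx R := sqrtC z.

(* Main.v *)
Require Import Defs.
From HB Require Import structures.
From mathcomp Require Import all_boot all_order all_algebra.
From mathcomp Require Import all_classical all_reals all_analysis.
From mathcomp Require Import complex.
From mathcomp Require Import measurable_realfun.
From mathcomp Require Import ring lra.

Set Implicit Arguments.
Unset Strict Implicit.
Unset Printing Implicit Defensive.

Import Order.TTheory GRing.Theory Num.Theory.
Import numFieldNormedType.Exports.

Local Open Scope classical_set_scope.
Local Open Scope ring_scope.

(* Each equation is a first-order quasilinear equation, solved by the method of
   characteristics.  Going backwards from (t, z), the candidate path Z(s) and
   the candidate value g / p(s) of the transform along it are explicit, and
   u(s) = p(s) L_s(Z(s)) - g solves a linear homogeneous equation with bounded
   coefficient as long as Z stays away from the support, so u = 0 by Gronwall;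
   s = 0 gives the functional equation.  The chain rule for L_s(Z(s)) needs only
   the time derivative at fixed z and the weak continuity of the process.

   With L_s(y) the integral of 1/(y - phi(x)), take phi(x) = x in (i),
   phi(x) = |x| in (ii) and phi(x) = x^2 in (iii), where G(z) = z L(z^2) turns
   the equation into that of (ii) on the plane slit along [0, oo).

   The path must not leave the domain.  In (i), Im Z grows backwards since
   Im G < 0; in (ii), since Im (z G(z)) <= 0.  In (iii) the remaining case is the
   negative axis z^2 = -r.  There H(t, r) = -L_t(-r) must satisfy
   r H(t, r) >= 1 - lambda, that is, the measures have an atom of mass at least
   1 - lambda at 0; this is forced by the existence of the process for all
   times. *)

(** * Complex numbers in components *)

Section ComplexComponents.
Context {R : realType}.
Implicit Types (z w : cplx R) (a b : R).

Local Notation Re := (@complex.Re R).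
Local Notation Im := (@complex.Im R).

Lemma cplx_eq z w : Re z = Re w -> Im z = Im w -> z = w.
Proof. by case: z w => [a b] [c d] /= -> ->. Qed.

Lemma cReD z w : Re (z + w) = Re z + Re w. Proof. by case: z w => [? ?] []. Qed.
Lemma cImD z w : Im (z + w) = Im z + Im w. Proof. by case: z w => [? ?] []. Qed.
Lemma cReN z : Re (- z) = - Re z. Proof. by case: z. Qed.
Lemma cImN z : Im (- z) = - Im z. Proof. by case: z. Qed.
Lemma cReM z w : Re (z * w) = Re z * Re w - Im z * Im w.
Proof. by case: z w => [? ?] []. Qed.
Lemma cImM z w : Im (z * w) = Re z * Im w + Im z * Re w.
Proof. by case: z w => [? ?] []. Qed.
Lemma cReV z : Re (z^-1) = Re z / (Re z ^+ 2 + Im z ^+ 2).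
Proof. by case: z. Qed.
Lemma cImV z : Im (z^-1) = - Im z / (Re z ^+ 2 + Im z ^+ 2).
Proof. by case: z => a b /=; rewrite mulNr. Qed.
Lemma cRe0 : Re (0 : cplx R) = 0. Proof. by []. Qed.
Lemma cIm0 : Im (0 : cplx R) = 0. Proof. by []. Qed.
Lemma cRe1 : Re (1 : cplx R) = 1. Proof. by []. Qed.
Lemma cIm1 : Im (1 : cplx R) = 0. Proof. by []. Qed.

Lemma toCD a b : toC (a + b) = toC a + toC b. Proof. exact: rmorphD. Qed.
Lemma toCB a b : toC (a - b) = toC a - toC b. Proof. exact: rmorphB. Qed.
Lemma toCM a b : toC (a * b) = toC a * toC b. Proof. exact: rmorphM. Qed.
Lemma toCN a : toC (- a) = - toC a. Proof. exact: rmorphN. Qed.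
Lemma toCV a : toC a^-1 = (toC a)^-1. Proof. exact: fmorphV. Qed.
Lemma toC0 : toC (0 : R) = 0. Proof. by []. Qed.
Lemma toC1 : toC (1 : R) = 1. Proof. by []. Qed.

Definition compE := (cReD, cImD, cReN, cImN, cReM, cImM, cRe0, cIm0, cRe1, cIm1).

(* The l1 norm, a submultiplicative norm with values in [R]; the norm of
   [cplx R] takes its values in [cplx R] itself. *)
Definition cn z : R := `|Re z| + `|Im z|.

Lemma cn_ge0 z : 0 <= cn z. Proof. by rewrite addr_ge0. Qed.
Lemma Re_le_cn z : `|Re z| <= cn z. Proof. by rewrite lerDl. Qed.
Lemma Im_le_cn z : `|Im z| <= cn z. Proof. by rewrite lerDr. Qed.
Lemma cnN z : cn (- z) = cn z. Proof. by rewrite /cn cReN cImN !normrN. Qed.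

Lemma cnD z w : cn (z + w) <= cn z + cn w.
Proof.
rewrite /cn cReD cImD.
have := ler_normD (Re z) (Re w); have := ler_normD (Im z) (Im w); lra.
Qed.

Lemma cnB z w : cn (z - w) <= cn z + cn w.
Proof. by rewrite -(cnN w); exact: cnD. Qed.

Lemma cnM z w : cn (z * w) <= cn z * cn w.
Proof.
rewrite /cn cReM cImM.
have := ler_normB (Re z * Re w) (Im z * Im w).
have := ler_normD (Re z * Im w) (Im z * Re w).
rewrite !normrM; lra.
Qed.

Lemma cn_toC a : cn (toC a) = `|a|.
Proof. by rewrite /cn /= normr0 addr0. Qed.

Lemma sqmod_gt0 z : 0 < cn z -> 0 < Re z ^+ 2 + Im z ^+ 2.
Proof.
rewrite /cn => h; rewrite lt_def addr_ge0 ?sqr_ge0 // andbT.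
rewrite paddr_eq0 ?sqr_ge0 // !sqrf_eq0; apply/negP => /andP[/eqP r0 /eqP i0].
by move: h; rewrite r0 i0 normr0 addr0 ltxx.
Qed.

Lemma cn_gt0_neq0 z : 0 < cn z -> z != 0.
Proof. by move=> h; apply/eqP => z0; move: h; rewrite z0 /cn /= normr0 addr0 ltxx. Qed.

(** The factor 2 compares the l1 norm with the modulus: [cn z ^+ 2] is at most twice the squared
    modulus, and [cn z^-1] is [cn z] over the squared modulus. *)
Lemma cnV z (d : R) : 0 < d -> d <= cn z -> cn z^-1 <= 2 / d.
Proof.
move=> d0 dz; have z0 := lt_le_trans d0 dz; have n0 := sqmod_gt0 z0.
rewrite /cn cReV cImV !normrM normrN -mulrDl -/(cn z).
rewrite (ger0_norm (x := _^-1)); last by rewrite invr_ge0 ltW.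
rewrite ler_pdivrMr // mulrAC ler_pdivlMr //.
have h2 : cn z ^+ 2 <= 2 * (Re z ^+ 2 + Im z ^+ 2).
  rewrite /cn -(real_normK (num_real (Re z))) -(real_normK (num_real (Im z))).
  have := sqr_ge0 (`|Re z| - `|Im z|); nra.
nra.
Qed.

End ComplexComponents.

(** * Componentwise convergence of complex-valued functions *)

Section ComplexLimits.
Context {R : realType}.

Local Notation Re := (@complex.Re R).
Local Notation Im := (@complex.Im R).

(** Integrals and derivatives are handled through real and imaginary parts, so limits are too;
    [cvg_ccvg] and [ccvg_cvg] show that this is convergence in [cplx R]. *)
Definition ccvg {T : Type} (F : set_system T) (f : T -> cplx R) (l : cplx R) :=
  (Re (f x) @[x --> F] --> Re l) /\ (Im (f x) @[x --> F] --> Im l).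

Context {T : Type} (F : set_system T) {FF : Filter F}.
Implicit Types (f g : T -> cplx R) (l m : cplx R).

Lemma ccvg_cst l : ccvg F (fun=> l) l.
Proof. by split; exact: cvg_cst. Qed.

Lemma ccvgD f g l m : ccvg F f l -> ccvg F g m ->
  ccvg F (fun x => f x + g x) (l + m).
Proof.
move=> [f1 f2] [g1 g2]; rewrite /ccvg cReD cImD.
by split; under eq_fun do rewrite ?cReD ?cImD; exact: cvgD.
Qed.

Lemma ccvgN f l : ccvg F f l -> ccvg F (fun x => - f x) (- l).
Proof.
move=> [f1 f2]; rewrite /ccvg cReN cImN.
by split; under eq_fun do rewrite ?cReN ?cImN; exact: cvgN.
Qed.

Lemma ccvgB f g l m : ccvg F f l -> ccvg F g m ->
  ccvg F (fun x => f x - g x) (l - m).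
Proof. by move=> fl gm; apply: ccvgD => //; exact: ccvgN. Qed.

Lemma ccvgM f g l m : ccvg F f l -> ccvg F g m ->
  ccvg F (fun x => f x * g x) (l * m).
Proof.
move=> [f1 f2] [g1 g2]; rewrite /ccvg cReM cImM.
split; under eq_fun do rewrite ?cReM ?cImM; [apply: cvgB|apply: cvgD]; exact: cvgM.
Qed.

Lemma ccvg_cn f l : ccvg F f l -> cn (f x - l) @[x --> F] --> (0 : R).
Proof.
move=> fl; have [h1 h2] := ccvgB fl (ccvg_cst l).
rewrite subrr in h1 h2.
rewrite -[X in _ --> X]addr0.
by apply: cvgD; rewrite -(normr0 R); apply: cvg_norm.
Qed.

Lemma ccvg_le f l (e : T -> R) : (\forall x \near F, cn (f x - l) <= e x) ->
  e x @[x --> F] --> (0 : R) -> ccvg F f l.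
Proof.
move=> fe e0.
have sq (h : T -> R) (c : R) : (forall x, `|h x - c| <= cn (f x - l)) ->
    h x @[x --> F] --> c.
  move=> hc; apply/cvgrPdist_le => eps eps0.
  move/cvgrPdist_le : e0 => /(_ _ eps0) e0.
  near=> x; rewrite distrC (le_trans (hc x)) //.
  have h1 : cn (f x - l) <= e x by near: x.
  have h2 : `|0 - e x| <= eps by near: x.
  rewrite (le_trans h1) // (le_trans _ h2) // sub0r normrN ler_norm //.
by split; apply: sq => x; rewrite -(cReN, cImN) -(cReD, cImD) (Re_le_cn, Im_le_cn).
Unshelve. all: end_near. Qed.

Lemma cvg_ccvg f l : f x @[x --> F] --> l -> ccvg F f l.
Proof.
move=> fl; apply: (@ccvg_le _ _ (fun x => cn (f x - l))).
  by near=> x.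
apply/cvgrPdist_lt => e e0.
have e0' : (0 : cplx R) < toC (e / 2) by rewrite ltcR divr_gt0.
move/cvgrPdist_lt : fl => /(_ _ e0') fl.
near=> x; rewrite sub0r normrN ger0_norm ?cn_ge0 //.
have : `|l - f x| < toC (e / 2) by near: x.
rewrite distrC; move: (f x - l) => [a b] /=.
rewrite ltcE /= => /andP[_]; rewrite /cn /= => h.
have ha : `|a| <= Num.sqrt (a ^+ 2 + b ^+ 2).
  by rewrite -sqrtr_sqr ler_wsqrtr // lerDl sqr_ge0.
have hb : `|b| <= Num.sqrt (a ^+ 2 + b ^+ 2).
  by rewrite -sqrtr_sqr ler_wsqrtr // lerDr sqr_ge0.
lra.
Unshelve. all: end_near. Qed.

Lemma ccvg_cvg f l : ccvg F f l -> f x @[x --> F] --> l.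
Proof.
move=> /ccvg_cn fl; apply/cvgrPdist_lt => e.
(* A positive element of [cplx R] is a positive real: its imaginary part is 0. *)
case: e => e i; rewrite ltcE /= => /andP[/eqP i0 e0]; rewrite {}i0 {i}.
move/cvgrPdist_lt : fl => /(_ _ e0) fl.
near=> x; rewrite distrC.
have : `|0 - cn (f x - l)| < e by near: x.
rewrite sub0r normrN ger0_norm ?cn_ge0 //.
move: (f x - l) => [a b] /=; rewrite /cn ltcE /= eqxx /=.
apply: le_lt_trans; rewrite -[leRHS]ger0_norm ?addr_ge0 // -sqrtr_sqr ler_wsqrtr //.
rewrite -(real_normK (num_real a)) -(real_normK (num_real b)).
have := normr_ge0 a; have := normr_ge0 b; nra.
Unshelve. all: end_near. Qed.

End ComplexLimits.

(** * Derivatives along a real parameter and a Gronwall argument *)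

Section ComplexDerivatives.
Context {R : realType}.
Implicit Types (f g : R -> cplx R) (s : R) (l m : cplx R).

Local Notation Re := (@complex.Re R).
Local Notation Im := (@complex.Im R).

Definition cderiv f s l :=
  is_derive s (1 : R) (fun x => Re (f x)) (Re l) /\
  is_derive s (1 : R) (fun x => Im (f x)) (Im l).

Lemma cderiv_cst l s : cderiv (fun=> l) s 0.
Proof. by split; exact: is_derive_cst. Qed.

Lemma cderiv_toC s : cderiv (fun x => toC x) s 1.
Proof. by split; [exact: is_derive_id|exact: is_derive_cst]. Qed.

Lemma cderivD f g s l m : cderiv f s l -> cderiv g s m ->
  cderiv (fun x => f x + g x) s (l + m).
Proof.
move=> [? ?] [? ?]; rewrite /cderiv cReD cImD.
by split; under eq_fun do rewrite ?cReD ?cImD; exact: is_deriveD.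
Qed.

Lemma cderivN f s l : cderiv f s l -> cderiv (fun x => - f x) s (- l).
Proof.
move=> [? ?]; rewrite /cderiv cReN cImN.
by split; under eq_fun do rewrite ?cReN ?cImN; exact: is_deriveN.
Qed.

Lemma cderivB f g s l m : cderiv f s l -> cderiv g s m ->
  cderiv (fun x => f x - g x) s (l - m).
Proof. by move=> fl gm; apply: cderivD => //; exact: cderivN. Qed.

Lemma cderivM f g s l m : cderiv f s l -> cderiv g s m ->
  cderiv (fun x => f x * g x) s (l * g s + f s * m).
Proof.
move=> [f1 f2] [g1 g2]; rewrite /cderiv !compE.
split.
  under eq_fun do rewrite cReM.
  have D := is_deriveB (is_deriveM f1 g1) (is_deriveM f2 g2).
  by apply: is_derive_eq; rewrite /GRing.scale /=; ring.
under eq_fun do rewrite cImM.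
have D := is_deriveD (is_deriveM f1 g2) (is_deriveM f2 g1).
by apply: is_derive_eq; rewrite /GRing.scale /=; ring.
Qed.

Lemma cderiv_eq f s l m : cderiv f s l -> l = m -> cderiv f s m.
Proof. by move=> ? <-. Qed.

Lemma cderiv_ccvg f s l :
  ccvg (0 : R)^' (fun h : R => toC h^-1 * (f (h + s) - f s)) l <-> cderiv f s l.
Proof.
have E1 : (fun h : R => Re (toC h^-1 * (f (h + s) - f s))) =
    (fun h => h^-1 *: (((fun x => Re (f x)) \o shift s) (h *: 1) - Re (f s))).
  by apply/funext => h; rewrite !compE /= mul0r subr0 /GRing.scale /= mulr1.
have E2 : (fun h : R => Im (toC h^-1 * (f (h + s) - f s))) =
    (fun h => h^-1 *: (((fun x => Im (f x)) \o shift s) (h *: 1) - Im (f s))).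
  by apply/funext => h; rewrite !compE /= mul0r addr0 /GRing.scale /= mulr1.
rewrite /ccvg E1 E2; split.
  move=> [h1 h2]; split.
    apply: DeriveDef; first by apply/cvg_ex; exists (Re l).
    exact/cvg_lim.
  apply: DeriveDef; first by apply/cvg_ex; exists (Im l).
  exact/cvg_lim.
move=> [[d1 e1] [d2 e2]]; split.
  rewrite -e1; exact: d1.
rewrite -e2; exact: d2.
Qed.

Lemma cderiv_continuous f s l : cderiv f s l -> ccvg (nbhs s) f (f s).
Proof.
move=> [[h1 _] [h2 _]]; split.
  by move/derivable1_diffP/differentiable_continuous : h1.
by move/derivable1_diffP/differentiable_continuous : h2.
Qed.

(** At an interior time the constraint [0 <= s + h] holds for all [h] near 0, so the derivative
    relative to the half-line is an ordinary one. *)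
Lemma time_derive_cderiv f s l : 0 < s -> is_time_derive f s l -> cderiv f s l.
Proof.
move=> s0; rewrite /is_time_derive => /cvg_ccvg H; apply/cderiv_ccvg.
have : ccvg (within [set h | 0 <= s + h] (0 : R)^') (fun h => toC h^-1 * (f (h + s) - f s)) l.
  have E : (fun h => (f (s + h) - f s) / toC h) = (fun h => toC h^-1 * (f (h + s) - f s)).
    by apply/funext => h; rewrite toCV mulrC (addrC s).
  by rewrite -E.
suff -> : within [set h | 0 <= s + h] (0 : R)^' = (0 : R)^' by [].
rewrite predeqE => A; split => [|]; rewrite /within /=.
  move=> h; near=> x.
  have : 0 <= s + x -> A x by near: x.
  apply.
  have : `|x| < s by near: x; apply: dnbhs0_lt.
  rewrite ltr_norml; lra.
by move=> h; near=> x => _; near: x.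
Unshelve. all: end_near. Qed.

(** The squared modulus [N] of [u] satisfies [N' = - 2 Re k * N]. Multiplied by [expR (q * x)] it is
    nondecreasing for [q = 2 * K], used to the left of [c], and nonincreasing for [q = - (2 * K)],
    used to the right. Being nonnegative and zero at [c], it vanishes on both sides. *)
Lemma cgronwall (u k : R -> cplx R) (a b c K : R) :
  (forall s, s \in `[a, b] -> ccvg (within `[a, b] (nbhs s)) u (u s)) ->
  (forall s, s \in `]a, b[ -> cderiv u s (- (k s * u s))) ->
  (forall s, s \in `]a, b[ -> cn (k s) <= K) ->
  c \in `[a, b] -> u c = 0 -> forall s, s \in `[a, b] -> u s = 0.
Proof.
move=> uc ud kK cab uc0 s sab.
pose N x := Re (u x) ^+ 2 + Im (u x) ^+ 2.
have N_ge0 x : 0 <= N x by rewrite addr_ge0 ?sqr_ge0.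
suff N0 : N s = 0.
  move/eqP : N0; rewrite paddr_eq0 ?sqr_ge0 // !sqrf_eq0 => /andP[/eqP ? /eqP ?].
  exact: cplx_eq.
pose psi (q x : R) := N x * expR (q * x).
have psic q : {within `[a, b], continuous (psi q)}.
  apply/subspace_continuousP => x xab.
  have [h1 h2] := uc x xab.
  apply: cvgM; first by apply: cvgD; rewrite expr2; under eq_fun do rewrite expr2; exact: cvgM.
  apply: cvg_within_filter.
  apply: (@continuous_comp _ _ _ ( *%R q) expR); last exact: continuous_expR.
  exact: mulrl_continuous.
have psid q x : x \in `]a, b[ -> is_derive x (1 : R) (psi q) ((q - 2 * Re (k x)) * psi q x).
  move=> xab; have [d1 d2] := ud x xab.
  have d3 : is_derive x (1 : R) (fun x => expR (q * x)) (q * expR (q * x)).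
    have d4 : is_derive x (1 : R) (fun x => q * x) q.
      by have D := is_deriveZ q (is_derive_id x (1 : R));
      apply: is_derive_eq; rewrite /GRing.scale /= mulr1.
    have D := is_derive1_comp (is_derive_expR (q * x)) d4.
    by apply: is_derive_eq; rewrite /= mulrC.
  have dN : is_derive x (1 : R) N (- (2 * Re (k x)) * N x).
    have D := is_deriveD (is_deriveM d1 d1) (is_deriveM d2 d2).
    suff H : is_derive x (1 : R) ((fun x => Re (u x)) * (fun x => Re (u x)) +
        (fun x => Im (u x)) * (fun x => Im (u x))) (- (2 * Re (k x)) * N x).
      by move: H; congr is_derive; apply/funext => y; rewrite /N !expr2.
    apply: is_derive_eq; rewrite /GRing.scale /= !compE.
    set v := u x; set w := k x; rewrite /N -/v !expr2.
    ring.
  have D := is_deriveM dN d3.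
  by apply: is_derive_eq; rewrite /GRing.scale /= /psi; ring.
have ReK x : x \in `]a, b[ -> - K <= Re (k x) <= K.
  by move=> /kK h; rewrite -ler_norml (le_trans (Re_le_cn _)).
have psi_ge0 q x : 0 <= psi q x by rewrite mulr_ge0 ?expR_ge0.
have psic0 q : psi q c = 0 by rewrite /psi /N uc0 /= expr0n /= addr0 mul0r.
suff [q psis] : exists q, psi q s <= 0.
  have : psi q s = 0 by apply/eqP; rewrite eq_le psis psi_ge0.
  by move/eqP; rewrite mulf_eq0 (gt_eqF (expR_gt0 _)) orbF => /eqP.
have [sc|/ltW cs] := leP s c.
  exists (2 * K); rewrite -(psic0 (2 * K)).
  apply: (@ger0_derive1_le_cc _ (psi (2 * K)) a b) => //.
  - by move=> x /(psid (2 * K)) [].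
  - move=> x xab; rewrite derive1E; have D := psid (2 * K) x xab.
    rewrite derive_val mulr_ge0 //; have := ReK x xab; lra.
exists (- (2 * K)); rewrite -(psic0 (- (2 * K))).
apply: (@ler0_derive1_le_cc _ (psi (- (2 * K))) a b) => //.
- by move=> x /(psid (- (2 * K))) [].
- move=> x xab; rewrite derive1E; have D := psid (- (2 * K)) x xab.
  rewrite derive_val mulr_le0_ge0 //; have := ReK x xab; lra.
Qed.

End ComplexDerivatives.

(** * Complex-valued integrals and resolvents *)

Section ComplexIntegral.
Context {R : realType}.
Implicit Types (mu : bprob R) (f g : R -> cplx R) (c : cplx R).

Local Notation Re := (@complex.Re R).
Local Notation Im := (@complex.Im R).

Lemma ccvgV {T : Type} (F : set_system T) {FF : Filter F} (h : T -> cplx R) (l : cplx R) :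
  ccvg F h l -> l != 0 -> ccvg F (fun x => (h x)^-1) l^-1.
Proof. by move=> fl l0; apply: cvg_ccvg; apply: cvgV l0 _; exact: ccvg_cvg. Qed.

Lemma ccvg_toC {T : Type} (F : set_system T) {FF : Filter F} (h : T -> R) (l : R) :
  h x @[x --> F] --> l -> ccvg F (fun x => toC (h x)) (toC l).
Proof. by move=> hl; split => //=; exact: cvg_cst. Qed.

Definition ccbounded f :=
  (forall x : R, ccvg (nbhs x) f (f x)) /\ exists M, forall x, cn (f x) <= M.

Lemma ccbounded_cst c : ccbounded (fun=> c).
Proof. by split; [move=> x; exact: ccvg_cst|exists (cn c)]. Qed.

Lemma ccboundedD f g : ccbounded f -> ccbounded g -> ccbounded (fun x => f x + g x).
Proof.
move=> [fc [M fM]] [gc [N gN]]; split; first by move=> x; exact: ccvgD.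
by exists (M + N) => x; rewrite (le_trans (cnD _ _)) // lerD.
Qed.

Lemma ccboundedM f g : ccbounded f -> ccbounded g -> ccbounded (fun x => f x * g x).
Proof.
move=> [fc [M fM]] [gc [N gN]]; split; first by move=> x; exact: ccvgM.
by exists (M * N) => x; rewrite (le_trans (cnM _ _)) // ler_pM ?cn_ge0.
Qed.

Lemma ccbounded_Re f : ccbounded f ->
  continuous (fun x => Re (f x)) /\ bounded_fun (fun x => Re (f x)).
Proof.
move=> [fc [M fM]]; split; first by move=> x; exact: (fc x).1.
exists M; split; first exact: num_real.
move=> N MN x _ /=; apply: (le_trans (Re_le_cn _)).
exact: (le_trans (fM x) (ltW MN)).
Qed.

Lemma ccbounded_Im f : ccbounded f ->
  continuous (fun x => Im (f x)) /\ bounded_fun (fun x => Im (f x)).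
Proof.
move=> [fc [M fM]]; split; first by move=> x; exact: (fc x).2.
exists M; split; first exact: num_real.
move=> N MN x _ /=; apply: (le_trans (Im_le_cn _)).
exact: (le_trans (fM x) (ltW MN)).
Qed.

Lemma cbounded_integrable mu (h : R -> R) :
  continuous h -> bounded_fun h -> mu.-integrable setT (EFin \o h).
Proof.
move=> hc hb; apply: measurable_bounded_integrable => //.
- by rewrite (le_lt_trans (probability_le1 _ _)) ?ltry.
- exact: continuous_measurable_fun.
Qed.

(** A zero integral would make [h] vanish almost everywhere; as [h] vanishes nowhere, the whole line
    would be null, against total mass 1. *)
Lemma Rintegral_gt0 mu (h : R -> R) : continuous h -> bounded_fun h ->
  (forall x, 0 < h x) -> 0 < (\int[mu]_x h x)%R.
Proof.
move=> hc hb h0; rewrite lt_def Rintegral_ge0 ?andbT; last by move=> x _; exact: ltW.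
apply/eqP => i0; have hi := cbounded_integrable mu hc hb.
have i0' : (\int[mu]_x `|(h x)%:E| = 0)%E.
  under eq_integral do rewrite gee0_abs ?lee_fin ?ltW //.
  by rewrite -(fineK (integrable_fin_num measurableT hi)) -/(Rintegral _ _ _) i0.
have mh : measurable_fun setT (EFin \o h) by case/integrableP : hi.
have [A [mA A0 sA]] := (ae_eq_integral_abs mu measurableT mh).1 i0'.
have : (mu [set: R] = 0)%E.
  apply/eqP; rewrite -measure_le0 -A0 le_measure ?inE //.
  move=> x _; apply: sA => /= H; have /eqP := H I; by rewrite eqe gt_eqF.
by rewrite probability_setT => /eqP; rewrite onee_eq0.
Qed.

Lemma Rintegral_prob_cst mu (r : R) : (\int[mu]_x r)%R = r.
Proof.
rewrite Rintegral_cst // -[RHS]mulr1; congr (_ * _).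
exact: (congr1 fine (@probability_setT _ _ _ mu)).
Qed.

(** Built from the two real integrals exactly as [cauchy_transform], so that [stieltjes id] is
    convertible to it. *)
Definition cint mu f : cplx R := Complex (\int[mu]_x Re (f x))%R (\int[mu]_x Im (f x))%R.

Lemma eq_cint mu f g : f =1 g -> cint mu f = cint mu g.
Proof. by move=> /funext ->. Qed.

Lemma cintD mu f g : ccbounded f -> ccbounded g ->
  cint mu (fun x => f x + g x) = cint mu f + cint mu g.
Proof.
move=> cf cg; have [rf bf] := ccbounded_Re cf; have [rg bg] := ccbounded_Re cg.
have [jf kf] := ccbounded_Im cf; have [jg kg] := ccbounded_Im cg.
apply: cplx_eq; rewrite /= ?cReD ?cImD /=.
  under eq_Rintegral do rewrite cReD.
  by rewrite RintegralD //; exact: cbounded_integrable.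
under eq_Rintegral do rewrite cImD.
by rewrite RintegralD //; exact: cbounded_integrable.
Qed.

Lemma cintZ mu c f : ccbounded f -> cint mu (fun x => c * f x) = c * cint mu f.
Proof.
move=> cf; have [rf bf] := ccbounded_Re cf; have [jf kf] := ccbounded_Im cf.
have ir := cbounded_integrable mu rf bf; have ii := cbounded_integrable mu jf kf.
have Zi (r : R) (h : R -> R) : mu.-integrable setT (EFin \o h) ->
    mu.-integrable setT (EFin \o (fun x => r * h x)).
  by move=> hi; apply: (integrableZl measurableT r hi).
apply: cplx_eq; rewrite ?cReM ?cImM /=.
  under eq_Rintegral do rewrite cReM.
  by rewrite RintegralB ?RintegralZl //; exact: Zi.
under eq_Rintegral do rewrite cImM.
by rewrite RintegralD ?RintegralZl //; exact: Zi.
Qed.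

Lemma cn_cint mu f (M : R) : ccbounded f -> (forall x, cn (f x) <= M) ->
  cn (cint mu f) <= M.
Proof.
move=> cf fM; have [rf bf] := ccbounded_Re cf; have [jf kf] := ccbounded_Im cf.
have ir := cbounded_integrable mu rf bf; have ii := cbounded_integrable mu jf kf.
have h1 := le_normr_Rintegral measurableT ir.
have h2 := le_normr_Rintegral measurableT ii.
rewrite /cn /= (le_trans (lerD h1 h2)) // -RintegralD //; last 2 first.
- exact: integrable_norm.
- exact: integrable_norm.
rewrite -[leRHS](Rintegral_prob_cst mu).
apply: le_Rintegral => //.
  exact: (integrableD measurableT (integrable_norm ir) (integrable_norm ii)).
  apply: cbounded_integrable; first by move=> x; exact: cvg_cst.
  exact: bounded_cst.
by move=> x _; exact: fM.
Qed.

End ComplexIntegral.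

(** * Resolvent integrals: bounds, differences and the derivative in [z] *)

Section Resolvent.
Context {R : realType}.
Variable phi : R -> R.
Hypothesis phi_cont : continuous phi.
Implicit Types (mu : bprob R) (z y : cplx R) (d : R).

(** Distance to the whole range of [phi] rather than to a support, which makes the resolvent bounds
    uniform over all measures. *)
Definition separated d z := forall x, d <= cn (z - toC (phi x)).

(** The Cauchy transform of the push-forward of [mu] under [phi], written on the original line. *)
Definition stieltjes mu z : cplx R := cint mu (fun x => (z - toC (phi x))^-1).

(** Up to sign, the divided difference of [stieltjes mu] between [z] and [y]; on the diagonal, minus
    its derivative. *)
Definition stieltjes2 mu z y : cplx R :=
  cint mu (fun x => (z - toC (phi x))^-1 * (y - toC (phi x))^-1).

Lemma cn_resolvent d z x : 0 < d -> separated d z ->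
  cn (z - toC (phi x))^-1 <= 2 / d.
Proof. by move=> d0 zd; exact: cnV. Qed.

Lemma separated_neq0 d z x : 0 < d -> separated d z -> z - toC (phi x) != 0.
Proof. by move=> d0 zd; apply: cn_gt0_neq0; exact: lt_le_trans (zd x). Qed.

Lemma ccbounded_resolvent d z : 0 < d -> separated d z ->
  ccbounded (fun x => (z - toC (phi x))^-1).
Proof.
move=> d0 zd; split; last by exists (2 / d) => x; exact: cn_resolvent zd.
move=> x; apply: ccvgV; last exact: separated_neq0 zd.
by apply: ccvgB; [exact: ccvg_cst|apply: ccvg_toC; exact: phi_cont].
Qed.

Lemma ccbounded_resolvent2 d z y : 0 < d -> separated d z -> separated d y ->
  ccbounded (fun x => (z - toC (phi x))^-1 * (y - toC (phi x))^-1).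
Proof.
by move=> d0 zd yd; apply: ccboundedM;
  [exact: ccbounded_resolvent zd|exact: ccbounded_resolvent yd].
Qed.

Lemma cn_stieltjes mu d z : 0 < d -> separated d z -> cn (stieltjes mu z) <= 2 / d.
Proof.
move=> d0 zd; apply: cn_cint; first exact: ccbounded_resolvent zd.
by move=> x; exact: cn_resolvent zd.
Qed.

Lemma cn_stieltjes2 mu d z y : 0 < d -> separated d z -> separated d y ->
  cn (stieltjes2 mu z y) <= (2 / d) ^+ 2.
Proof.
move=> d0 zd yd; apply: cn_cint; first exact: ccbounded_resolvent2 zd yd.
move=> x; rewrite (le_trans (cnM _ _)) // expr2.
by rewrite ler_pM ?cn_ge0 // cn_resolvent.
Qed.

(** The resolvent identity, integrated. *)
Lemma stieltjesB mu d z y : 0 < d -> separated d z -> separated d y ->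
  stieltjes mu z - stieltjes mu y = - (z - y) * stieltjes2 mu z y.
Proof.
move=> d0 zd yd.
rewrite /stieltjes /stieltjes2 -cintZ; last exact: ccbounded_resolvent2 zd yd.
rewrite -[X in _ - X]mul1r -mulNr -cintZ; last exact: ccbounded_resolvent yd.
rewrite -cintD.
- apply: eq_cint => x.
  have := separated_neq0 x d0 zd; have := separated_neq0 x d0 yd => ? ?.
  by field; apply/andP.
- exact: ccbounded_resolvent zd.
- by apply: ccboundedM; [exact: ccbounded_cst|exact: ccbounded_resolvent yd].
Qed.

Lemma stieltjes2B mu d z y : 0 < d -> separated d z -> separated d y ->
  cn (stieltjes2 mu z y - stieltjes2 mu y y) <= cn (z - y) * (2 / d) ^+ 3.
Proof.
move=> d0 zd yd.
have zb := ccbounded_resolvent d0 zd; have yb := ccbounded_resolvent d0 yd.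
rewrite /stieltjes2 -[X in _ - X]mul1r -mulNr -cintZ; last exact: ccboundedM.
rewrite -cintD; last 2 first.
- exact: ccboundedM.
- by apply: ccboundedM; [exact: ccbounded_cst|exact: ccboundedM].
rewrite (@eq_cint _ _ _ (fun x => - (z - y) * ((z - toC (phi x))^-1 * (y - toC (phi x))^-1 *
  (y - toC (phi x))^-1))); last first.
  move=> x; have := separated_neq0 x d0 zd; have := separated_neq0 x d0 yd => ? ?.
  by field; apply/andP.
apply: cn_cint.
  by apply: ccboundedM; [exact: ccbounded_cst|apply: ccboundedM => //; exact: ccboundedM].
move=> x; rewrite (le_trans (cnM _ _)) // cnN ler_wpM2l ?cn_ge0 //.
have d2 : 0 <= 2 / d by rewrite divr_ge0 // ltW.
rewrite (le_trans (cnM _ _)) // exprSr ler_pM ?cn_ge0 //; last exact: cn_resolvent.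
by rewrite (le_trans (cnM _ _)) // expr2 ler_pM ?cn_ge0 // cn_resolvent.
Qed.

Lemma separated_near d z y : 0 < d -> separated d z -> cn (y - z) <= d / 2 ->
  separated (d / 2) y.
Proof.
move=> d0 zd yz x; have := zd x.
have -> : z - toC (phi x) = (y - toC (phi x)) - (y - z) by ring.
by have := cnB (y - toC (phi x)) (y - z); lra.
Qed.

Lemma separatedW d e z : e <= d -> separated d z -> separated e z.
Proof. by move=> ed zd x; exact: le_trans ed (zd x). Qed.

(** The difference quotient is exactly [- stieltjes2 mu (h + z) z], and [stieltjes2B] gives its
    limit. *)
Lemma derive1_stieltjes mu d z : 0 < d -> separated d z ->
  derive1 (stieltjes mu) z = - stieltjes2 mu z z.
Proof.
move=> d0 zd; rewrite /derive1; apply: cvg_lim => //; apply: ccvg_cvg.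
have d20 : 0 < d / 2 by rewrite divr_gt0.
have small : cn (h : cplx R) @[h --> (0 : cplx R)^'] --> (0 : R).
  have : ccvg (0 : cplx R)^' id (0 : cplx R).
    by apply: cvg_ccvg; exact: cvg_within.
  by move/ccvg_cn; under eq_fun do rewrite subr0.
apply: (@ccvg_le _ _ _ _ _ _ (fun h => cn h * (2 / (d / 2)) ^+ 3)); last first.
  by rewrite -[X in _ --> X](mul0r ((2 / (d / 2)) ^+ 3)); apply: cvgM => //; exact: cvg_cst.
near=> h.
have h0 : h != 0 by near: h; exact: nbhs_dnbhs_neq.
have hd : cn h <= d / 2.
  near: h; move/cvgrPdist_le : small => /(_ _ d20).
  by apply: filterS => h; rewrite sub0r normrN ger0_norm ?cn_ge0.
have hzd : separated (d / 2) (h + z).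
  by apply: (separated_near d0 zd); rewrite addrK.
have zd2 : separated (d / 2) z by apply: separatedW zd; lra.
rewrite (stieltjesB mu d20 hzd zd2) addrK -[_ *: _]/(_ * _).
rewrite mulrA mulrN mulVf // mulN1r -opprD cnN.
by have := stieltjes2B mu d20 hzd zd2; rewrite addrK.
Unshelve. all: end_near. Qed.

End Resolvent.

(** * Characteristics *)

Section Characteristics.
Context {R : realType}.
Variable phi : R -> R.
Hypothesis phi_cont : continuous phi.
Implicit Types (w : R -> bprob R) (z y : cplx R) (d t s : R).

Local Notation stieltjes := (stieltjes phi).
Local Notation stieltjes2 := (stieltjes2 phi).
Local Notation separated := (separated phi).

(** The filter is a parameter so as to cover the one-sided limit at time 0, limits within a segment
    and left limits. *)
Definition weakly_cvg w (F : set_system R) t :=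
  forall f, ccbounded f -> ccvg F (fun s => cint (w s) f) (cint (w t) f).

(** The moving point [Z s] is replaced by its limit [z], with an error uniform over the measures; at
    the fixed point weak convergence applies. *)
Lemma weakly_cvg_stieltjes2 w (F : set_system R) {FF : Filter F} t Z z d :
  weakly_cvg w F t -> ccvg F Z z -> 0 < d ->
  (\forall s \near F, separated d (Z s)) -> separated d z ->
  ccvg F (fun s => stieltjes2 (w s) (Z s) z) (stieltjes2 (w t) z z).
Proof.
move=> wt Zz d0 Zd zd.
have -> : (fun s => stieltjes2 (w s) (Z s) z) = (fun s =>
    stieltjes2 (w s) z z + (stieltjes2 (w s) (Z s) z - stieltjes2 (w s) z z)).
  by apply/funext => s; rewrite addrC subrK.
rewrite -[X in ccvg _ _ X]addr0; apply: ccvgD.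
  by apply: wt; exact: (ccbounded_resolvent2 phi_cont d0 zd zd).
apply: (@ccvg_le _ _ _ _ _ _ (fun s => cn (Z s - z) * (2 / d) ^+ 3)).
  near=> s; rewrite subr0; apply: stieltjes2B => //.
  by near: s.
rewrite -[X in _ --> X](mul0r ((2 / d) ^+ 3)); apply: cvgM; last exact: cvg_cst.
exact: ccvg_cn.
Unshelve. all: end_near. Qed.

Lemma weakly_cvg_stieltjes w (F : set_system R) {FF : Filter F} t Z z d :
  weakly_cvg w F t -> ccvg F Z z -> 0 < d ->
  (\forall s \near F, separated d (Z s)) -> separated d z ->
  ccvg F (fun s => stieltjes (w s) (Z s)) (stieltjes (w t) z).
Proof.
move=> wt Zz d0 Zd zd.
have -> : (fun s => stieltjes (w s) (Z s)) = (fun s =>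
    stieltjes (w s) z + (stieltjes (w s) (Z s) - stieltjes (w s) z)).
  by apply/funext => s; rewrite addrC subrK.
rewrite -[X in ccvg _ _ X]addr0; apply: ccvgD.
  by apply: wt; exact: ccbounded_resolvent zd.
apply: (@ccvg_le _ _ _ _ _ _ (fun s => cn (Z s - z) * (2 / d) ^+ 2)).
  near=> s; rewrite subr0.
  have Zsd : separated d (Z s) by near: s.
  rewrite (stieltjesB _ _ d0 Zsd zd) // (le_trans (cnM _ _)) // cnN ler_wpM2l ?cn_ge0 //.
  exact: cn_stieltjes2.
rewrite -[X in _ --> X](mul0r ((2 / d) ^+ 2)); apply: cvgM; last exact: cvg_cst.
exact: ccvg_cn.
Unshelve. all: end_near. Qed.

Lemma ccvg_shift (f : R -> cplx R) t l :
  ccvg (nbhs t) f l -> ccvg (0 : R)^' (fun h : R => f (h + t)) l.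
Proof.
have h0 : h + t @[h --> (0 : R)^'] --> t.
  rewrite -[X in _ --> X]add0r; apply: cvgD; last exact: cvg_cst.
  exact: cvg_within.
by move=> [f1 f2]; split; [exact: (cvg_comp _ _ h0 f1)|exact: (cvg_comp _ _ h0 f2)].
Qed.

(** The increment splits into a change of measure at the fixed point [Z t] and a change of point
    under the moving measure. The second is a divided difference, whose limit comes from
    [weakly_cvg_stieltjes2]. *)
Lemma cderiv_stieltjes w Z t dZ l d :
  weakly_cvg w (nbhs t) t -> cderiv Z t dZ -> 0 < d ->
  (\forall s \near t, separated d (Z s)) ->
  cderiv (fun s => stieltjes (w s) (Z t)) t l ->
  cderiv (fun s => stieltjes (w s) (Z s)) t (l - dZ * stieltjes2 (w t) (Z t) (Z t)).
Proof.
move=> wt dZt d0 Zd dl; have Ztd := nbhs_singleton Zd.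
have Zc := cderiv_continuous dZt.
have F2 := ccvg_shift (weakly_cvg_stieltjes2 wt Zc d0 Zd Ztd).
move/cderiv_ccvg : dl => dl; move/cderiv_ccvg : dZt => dZt.
apply/cderiv_ccvg.
have H := ccvgB dl (ccvgM dZt (F2 _)).
have E : \forall h \near (0 : R)^',
   toC h^-1 * (stieltjes (w (h + t)) (Z t) - stieltjes (w t) (Z t)) -
   toC h^-1 * (Z (h + t) - Z t) * stieltjes2 (w (h + t)) (Z (h + t)) (Z t) =
   toC h^-1 * (stieltjes (w (h + t)) (Z (h + t)) - stieltjes (w t) (Z t)).
  have h0 : h + t @[h --> (0 : R)^'] --> t.
    rewrite -[X in _ --> X]add0r; apply: cvgD; last exact: cvg_cst.
    exact: cvg_within.
  near=> h.
  have Zhd : separated d (Z (h + t)) by near: h; exact: (h0 _ Zd).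
  have := stieltjesB phi_cont (w (h + t)) d0 Zhd Ztd.
  set a := stieltjes (w (h + t)) (Z (h + t)); set b := stieltjes (w (h + t)) (Z t).
  by move=> /(canRL (subrK _)) ->; ring.
have near_eq (f g : R -> R) (m : R) : (\forall h \near (0 : R)^', f h = g h) ->
    f x @[x --> (0 : R)^'] --> m -> g x @[x --> (0 : R)^'] --> m.
  by move=> fg; apply: cvg_trans; apply: near_eq_cvg.
by case: H => H1 H2; split; [move: H1|move: H2]; apply: near_eq;
  apply: filterS E => h ->.
Unshelve. all: end_near. Qed.

Lemma ccontinuous_segment_bounded (A : R -> cplx R) (a b : R) : a <= b ->
  (forall s, ccvg (nbhs s) A (A s)) ->
  exists M, forall s, s \in `[a, b] -> cn (A s) <= M.
Proof.
move=> ab Ac.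
have cA : {within `[a, b], continuous (fun s => cn (A s))}.
  apply: continuous_subspaceT => s; have [h1 h2] := Ac s.
  by apply: cvgD; apply: cvg_norm.
by have [c _ cM] := EVT_max ab cA; exists (cn (A c)).
Qed.

(* The quantity [p L(Z) - g] satisfies a linear homogeneous differential
   equation along the path, hence vanishes as soon as it does so once. *)
Lemma characteristic_eq w (s0 s1 c d : R) (p Z A : R -> cplx R) (a k g : cplx R) :
  0 <= s0 ->
  (forall t, 0 <= t -> weakly_cvg w (within `[0, +oo[ (nbhs t)) t) ->
  0 < d -> (forall s, s \in `[s0, s1] -> separated d (Z s)) ->
  (forall s, s \in `]s0, s1[ ->
    let L := stieltjes (w s) (Z s) in
    exists2 l, cderiv (fun r => stieltjes (w r) (Z s)) s l &
      l - (A s * L - k) * stieltjes2 (w s) (Z s) (Z s) + a * L ^+ 2 = 0) ->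
  (forall s, cderiv p s (a * g)) ->
  (forall s, exists2 dZ, cderiv Z s dZ & p s * dZ = A s * g - k * p s) ->
  (forall s, ccvg (nbhs s) A (A s)) ->
  c \in `[s0, s1] -> p c * stieltjes (w c) (Z c) = g ->
  forall s, s \in `[s0, s1] -> p s * stieltjes (w s) (Z s) = g.
Proof.
move=> s00 wc d0 Zd pde dp dZ Ac cs pc s ss.
have s01 : s0 <= s1 by move: cs; rewrite in_itv /= => /andP[]; exact: le_trans.
have [M AM] := ccontinuous_segment_bounded s01 Ac.
pose u s := p s * stieltjes (w s) (Z s) - g.
(* Chosen so that [u' = - K u]: inserting the equation for [l] and the relation for [p s * dZ], the
   terms with [k] cancel and the rest factors through [u]. *)
pose K s := a * stieltjes (w s) (Z s) - A s * stieltjes2 (w s) (Z s) (Z s).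
suff : u s = 0 by move/eqP; rewrite subr_eq0 => /eqP.
have oc x : x \in `]s0, s1[ -> x \in `[s0, s1] by exact: subset_itv_oo_cc.
apply: (@cgronwall _ u K s0 s1 c (cn a * (2 / d) + M * (2 / d) ^+ 2)) => //.
- move=> x xs; have x0 : 0 <= x.
    by move: xs; rewrite in_itv /= => /andP[h _]; exact: le_trans h.
  have sub : within `[s0, s1] (nbhs x) `=>` within `[0, +oo[ (nbhs x).
    apply: within_subset => y /=; rewrite !in_itv /= andbT => /andP[h _].
    exact: le_trans h.
  have wx : weakly_cvg w (within `[s0, s1] (nbhs x)) x.
    move=> f cf; have [h1 h2] := wc x x0 f cf.
    by split; [move: h1|move: h2] => h; apply: cvg_trans h; exact: cvg_app.
  have cw (f : R -> cplx R) l : ccvg (nbhs x) f l -> ccvg (within `[s0, s1] (nbhs x)) f l.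
    by move=> [h1 h2]; split; exact: cvg_within_filter.
  apply: ccvgB; last exact: ccvg_cst.
  apply: ccvgM; first by apply: cw; exact: cderiv_continuous (dp x).
  apply: (weakly_cvg_stieltjes wx _ d0) => //; last exact: Zd.
    by apply: cw; have [? /cderiv_continuous] := dZ x.
  rewrite near_withinE; near=> y => ys; exact: Zd.
- move=> x xs; have [dZx h1 h2] := dZ x; have [l h3 h4] := pde x xs.
  have x0 : 0 < x.
    by move: xs; rewrite in_itv /= => /andP[h _]; exact: le_lt_trans h.
  have wx : weakly_cvg w (nbhs x) x.
    have := wc x (ltW x0); rewrite within_interior //.
    by rewrite interior_itv /= in_itv /= andbT.
  have near_sep : \forall y \near x, separated d (Z y).
    near=> y; apply: Zd; apply: oc; near: y; exact: near_in_itvoo.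
  have D := cderivB (cderivM (dp x) (cderiv_stieltjes wx h1 d0 near_sep h3)) (cderiv_cst g x).
  apply: (cderiv_eq D); rewrite subr0 /u /K.
  set L := stieltjes _ _ in h4 *; set S2 := stieltjes2 _ _ _ in h4 *.
  have -> : l = (A x * L - k) * S2 - a * L ^+ 2.
    by apply/eqP; rewrite -subr_eq0 -h4; apply/eqP; ring.
  rewrite mulrBr [p x * (dZx * _)]mulrA h2; ring.
- move=> x /oc xs; rewrite (le_trans (cnB _ _)) // lerD // (le_trans (cnM _ _)) //.
    rewrite ler_wpM2l ?cn_ge0 //; exact: cn_stieltjes (Zd _ xs).
  rewrite ler_pM ?cn_ge0 //; first exact: AM.
  exact: cn_stieltjes2 (Zd _ xs) (Zd _ xs).
- by rewrite /u pc subrr.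
Unshelve. all: end_near. Qed.

End Characteristics.

Lemma weakly_continuous_ccvg {R : realType} (E : set (bprob R)) w :
  weakly_continuous_process E w ->
  forall t : R, 0 <= t -> weakly_cvg w (within `[0, +oo[ (nbhs t)) t.
Proof.
move=> [_ wc] t t0 f cf; have [rc rb] := ccbounded_Re cf; have [jc jb] := ccbounded_Im cf.
have t0' : [set` `[0, +oo[] t by rewrite /= in_itv /= t0.
by split; [have /subspace_continuousP := wc _ rc rb|have /subspace_continuousP := wc _ jc jb];
  apply.
Qed.

(** * Explicit characteristics of the equation in (ii) *)

Section QuadraticCharacteristics.
Context {R : realType}.
Variable phi : R -> R.
Hypothesis phi_cont : continuous phi.
Hypothesis phi_ge0 : forall x, 0 <= phi x.
Implicit Types (z g : cplx R) (t s k : R).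

Local Notation Re := (@complex.Re R).
Local Notation Im := (@complex.Im R).
Local Notation stieltjes := (stieltjes phi).
Local Notation stieltjes2 := (stieltjes2 phi).
Local Notation separated := (separated phi).

(** With [g] the transform at the end of the path, at time [t], the value carried back to time [s]
    is [g] divided by this factor. *)
Definition char_factor g t s : cplx R := 1 - toC (t - s) * g.

(** The characteristic through [z] at time [t]; at [s = 0] it is the argument of the initial
    transform in the functional equation of (ii). *)
Definition char_point k z g t s : cplx R :=
  char_factor g t s * (toC k * toC (t - s) + char_factor g t s * z).

Lemma char_factor_id g t : char_factor g t t = 1.
Proof. by rewrite /char_factor subrr toC0 mul0r subr0. Qed.

Lemma char_point_id k z g t : char_point k z g t t = z.
Proof. by rewrite /char_point char_factor_id subrr toC0 mulr0 add0r !mul1r. Qed.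

Lemma cderiv_toC_rev t s : cderiv (fun s => toC (t - s)) s (-1).
Proof.
under eq_fun do rewrite toCB.
by apply: (cderiv_eq (cderivB (cderiv_cst (toC t) s) (cderiv_toC s))); rewrite sub0r.
Qed.

Lemma cderiv_char_factor g t s : cderiv (char_factor g t) s g.
Proof.
have D := cderivB (cderiv_cst 1 s) (cderivM (cderiv_toC_rev t s) (cderiv_cst g s)).
by apply: (cderiv_eq D); ring.
Qed.

Lemma cderiv_char_point k z g t s : exists2 dZ,
  cderiv (char_point k z g t) s dZ &
  char_factor g t s * dZ =
    (2 * char_point k z g t s) * g - toC k * char_factor g t s.
Proof.
have dp := cderiv_char_factor g t s.
have D := cderivM dp (cderivD (cderivM (cderiv_cst (toC k) s) (cderiv_toC_rev t s))
  (cderivM dp (cderiv_cst z s))).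
eexists; first exact: D.
by rewrite /char_point /char_factor; ring.
Qed.

(* The equation of (ii) for the transform [stieltjes], with [k = 1 - lambda];
   [- stieltjes2 phi mu z z] is the derivative of [stieltjes mu] at [z]. *)
Definition quadratic_pde (w : R -> bprob R) k (P : set (cplx R)) :=
  forall s z, 0 < s -> P z ->
  let L := stieltjes (w s) z in
  exists2 l, cderiv (fun r => stieltjes (w r) z) s l &
    l - (2 * z * L - toC k) * stieltjes2 (w s) z z + L ^+ 2 = 0.

Lemma quadratic_characteristic w k P z t s0 s1 d :
  (forall t, 0 <= t -> weakly_cvg w (within `[0, +oo[ (nbhs t)) t) ->
  quadratic_pde w k P -> 0 <= s0 -> 0 < d ->
  let g := stieltjes (w t) z in
  (forall s, s \in `[s0, s1] -> separated d (char_point k z g t s)) ->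
  (forall s, s \in `]s0, s1[ -> P (char_point k z g t s)) ->
  t \in `[s0, s1] ->
  forall s, s \in `[s0, s1] ->
    char_factor g t s * stieltjes (w s) (char_point k z g t s) = g.
Proof.
move=> wc pde s00 d0 g sep PZ ts.
apply: (@characteristic_eq _ _ phi_cont w s0 s1 t d _ _
  (fun s => 2 * char_point k z g t s) 1 (toC k) g) => //.
- move=> s ss; have sgt0 : 0 < s.
    by move: ss; rewrite in_itv /= => /andP[h _]; exact: le_lt_trans h.
  have [l dl pl] := pde s _ sgt0 (PZ s ss).
  by exists l => //; rewrite mul1r.
- by move=> s; rewrite mul1r; exact: cderiv_char_factor.
- move=> s; exact: cderiv_char_point.
- move=> s; apply: ccvgM; first exact: ccvg_cst.
  by have [dZ /cderiv_continuous] := cderiv_char_point k z g t s.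
- by rewrite char_factor_id char_point_id mul1r.
Qed.

Lemma Im_separated d z : d <= `|Im z| -> separated d z.
Proof.
move=> dz x; rewrite (le_trans dz) // (le_trans _ (Im_le_cn _)) //.
by rewrite cImD cImN /= subr0.
Qed.

Lemma Im_cint mu (f : R -> cplx R) : Im (cint mu f) = (\int[mu]_x Im (f x))%R.
Proof. by []. Qed.

(** The imaginary part of the kernel is [- Im z] over a squared modulus. The product with [Im z]
    treats both half-planes at once. *)
Lemma Im_stieltjes_lt0 mu z : Im z != 0 -> Im z * Im (stieltjes mu z) < 0.
Proof.
move=> z0; have d0 : 0 < `|Im z| by rewrite normr_gt0.
have zd : separated `|Im z| z by exact: Im_separated.
have cb := ccbounded_resolvent phi_cont d0 zd.
suff : 0 < Im (toC (- Im z) * stieltjes mu z).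
  by rewrite cImM /= mul0r addr0 mulNr oppr_gt0.
rewrite /stieltjes -cintZ // Im_cint.
have [rc rb] := ccbounded_Im (ccboundedM (ccbounded_cst (toC (- Im z))) cb).
apply: Rintegral_gt0 => // x.
have := sqmod_gt0 (lt_le_trans d0 (zd x)).
rewrite cImM /= mul0r addr0 cImV !compE /= subr0 => y0.
by rewrite mulrA mulrNN divr_gt0 // -expr2 lt_def sqr_ge0 sqrf_eq0 z0.
Qed.

(** For [r >= 0], [z / (z - r) = 1 + r / (z - r)], whose imaginary part never has the sign of
    [Im z]. *)
Lemma Im_mul_stieltjes_le0 mu z : Im z != 0 -> Im z * Im (z * stieltjes mu z) <= 0.
Proof.
move=> z0; have d0 : 0 < `|Im z| by rewrite normr_gt0.
have zd : separated `|Im z| z by exact: Im_separated.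
have cb := ccbounded_resolvent phi_cont d0 zd.
suff : 0 <= Im (toC (- Im z) * (z * stieltjes mu z)).
  by rewrite cImM /= mul0r addr0 mulNr oppr_ge0.
have zcb := ccboundedM (ccbounded_cst z) cb.
rewrite /stieltjes -cintZ // -cintZ // Im_cint; apply: Rintegral_ge0 => x _.
suff H (r : R) : 0 <= r -> 0 < cn (z - toC r) ->
    0 <= Im (toC (- Im z) * (z * (z - toC r)^-1)).
  by apply: H; [exact: phi_ge0|exact: lt_le_trans d0 (zd x)].
move=> r0; have [y ->] : exists y, z = y + toC r by exists (z - toC r); rewrite subrK.
rewrite addrK => y0; have n0 := sqmod_gt0 y0.
rewrite mulrDl mulfV ?cn_gt0_neq0 // !compE /= cImV !mul0r !addr0 add0r.
rewrite (_ : _ * _ = Im y ^+ 2 * r / (Re y ^+ 2 + Im y ^+ 2)); last first.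
  by field; exact: lt0r_neq0 n0.
by apply: divr_ge0; [exact: mulr_ge0 (sqr_ge0 _) r0|exact: ltW n0].
Qed.

Lemma cderiv_cvg_Im f s l : cderiv f s l -> {for s, continuous (fun x : R => Im (f x))}.
Proof. by move=> /cderiv_continuous [_]. Qed.

(* Going backwards along a characteristic moves away from the real axis, since
   [Im z * Im (z L(z)) <= 0] when the measures live on the nonnegative
   half-line; hence the path never leaves its half-plane. *)
Lemma quadratic_characteristic_Im w k t z :
  (forall t, 0 <= t -> weakly_cvg w (within `[0, +oo[ (nbhs t)) t) ->
  Im z != 0 -> 0 <= t ->
  quadratic_pde w k [set y | 0 < Im z * Im y] ->
  let g := stieltjes (w t) z in
  forall s, s \in `[0, t] -> 0 < Im z * Im (char_point k z g t s) /\
    char_factor g t s * stieltjes (w s) (char_point k z g t s) = g.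
Proof.
move=> wc z0 t0 pde g; set Z := char_point k z g t.
have e0 : 0 < Im z ^+ 2 by rewrite lt_def sqr_ge0 sqrf_eq0 z0.
have iz0 : 0 < `|Im z| by rewrite normr_gt0.
pose f s := Im z * Im (Z s).
have fc : continuous f.
  move=> s; apply: cvgM; first exact: cvg_cst.
  have [dZ h _] := cderiv_char_point k z g t s; exact: cderiv_cvg_Im h.
have ft : f t = Im z ^+ 2 by rewrite /f /Z char_point_id expr2.
have sepf s : Im z ^+ 2 / 2 <= f s -> separated (`|Im z| / 2) (Z s).
  move=> h; apply: Im_separated; rewrite -(ler_pM2l iz0) -normrM.
  rewrite mulrA -expr2 real_normK ?num_real //.
  exact: le_trans h (ler_norm _).
(* While [f] stays above half of its value at [t], the path is separated from the real axis and the
   transform is known along it. *)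
have match_from m : 0 <= m -> m <= t ->
    (forall s, s \in `[m, t] -> Im z ^+ 2 / 2 <= f s) ->
    forall s, s \in `[m, t] -> char_factor g t s * stieltjes (w s) (Z s) = g.
  move=> m0 mt hf; apply: (@quadratic_characteristic w k _ z t m t (`|Im z| / 2) wc pde) => //.
  - by apply: divr_gt0.
  - by move=> r /hf; exact: sepf.
  - move=> r rs /=; apply: (lt_le_trans (y := Im z ^+ 2 / 2)); first by apply: divr_gt0.
    by apply: hf; exact: subset_itv_oo_cc.
  - by rewrite in_itv /= mt lexx.
have g0 : g != 0.
  by apply/eqP => gE; have := Im_stieltjes_lt0 (w t) z0; rewrite -/g gE /= mulr0 ltxx.
suff H s : s \in `[0, t] -> Im z ^+ 2 / 2 < f s.
  move=> s st; split; last by apply: (match_from 0) s st => // s st; exact: ltW (H s st).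
  by apply: lt_trans (H s st); apply: divr_gt0.
move=> st; rewrite ltNge; apply/negP => fs.
(* The supremum [m] of [S] is the last time at which [f] is at most half of [f t]. From [m] to [t]
   the identity holds and [f] is nonincreasing, so [f t <= f m], which is absurd. *)
pose S := [set s | s \in `[0, t] /\ f s <= Im z ^+ 2 / 2].
have Sb : has_ubound S by exists t => y [] /=; rewrite in_itv /= => /andP[].
have Sn : S !=set0 by exists s.
have Scl : closed S.
  apply: closedI; first exact: interval_closed.
  exact: (closed_comp (fun x _ => fc x) (@closed_le _ (Im z ^+ 2 / 2))).
have /(_ Sn Sb) := @closure_sup _ S; rewrite -(closure_id S).1 //; set m := sup S.
move=> [mt fm]; have /andP[m0 mt'] : 0 <= m <= t by move: mt; rewrite in_itv.
have leS r : r \in `[m, t] -> f r <= Im z ^+ 2 / 2 -> r <= m.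
  rewrite in_itv /= => /andP[mr rt] fr; apply: ub_le_sup => //; split => //.
  by rewrite in_itv /= rt (le_trans m0 mr).
have fmE : f m = Im z ^+ 2 / 2.
  have [||r rm fr] := @IVT _ f m t (Im z ^+ 2 / 2) mt'.
  - exact: continuous_subspaceT.
  - by rewrite ft ge_min le_max fm; apply/orP; right; lra.
  have rm' : r = m.
    apply/eqP; rewrite eq_le leS ?fr //=.
    by move: rm; rewrite in_itv /= => /andP[].
  by rewrite -fr rm'.
have above r : r \in `[m, t] -> Im z ^+ 2 / 2 <= f r.
  move=> rm; rewrite leNgt; apply/negP => fr; have rm' := leS r rm (ltW fr).
  have : r = m by apply/eqP; rewrite eq_le rm'; move: rm; rewrite in_itv /= => /andP[].
  by move=> rE; move: fr; rewrite rE fmE ltxx.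
have mtc := match_from m m0 mt' above.
have df r : r \in `]m, t[ -> exists2 df, is_derive r (1 : R) f df & df <= 0.
  move=> /subset_itv_oo_cc rm; have [dZ [_ dI] hZ] := cderiv_char_point k z g t r.
  exists (Im z * Im dZ).
    have D := is_deriveZ (Im z) dI.
    by apply: (@is_derive_eq _ _ _ _ _ _ _ _ D).
  have p0 : char_factor g t r != 0.
    by apply: contraNneq g0 => p0; rewrite -(mtc r rm) p0 mul0r.
  (* The factor is nonzero because [g] is, so it can be divided out; [k] is real and does not affect
     the imaginary part of the velocity. *)
  have -> : dZ = 2 * (Z r * stieltjes (w r) (Z r)) - toC k.
    apply: (mulfI p0); rewrite hZ -/Z.
    have -> : 2 * Z r * g = 2 * Z r * (char_factor g t r * stieltjes (w r) (Z r)).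
      by rewrite mtc.
    ring.
  have fr0 : 0 < f r by apply: lt_le_trans (above r rm); apply: divr_gt0.
  have Zr0 : Im (Z r) != 0.
    by apply: contraTneq fr0; rewrite /f => ->; rewrite mulr0 ltxx.
  have := Im_mul_stieltjes_le0 (w r) Zr0; rewrite mulr_natl mulr2n !cImD cImN /= subr0.
  set v := Im (Z r * stieltjes _ _) => hv.
  have : f r * (Im (Z r) * v) <= 0 by apply: mulr_ge0_le0 => //; exact: ltW.
  have Zr2 : 0 < Im (Z r) ^+ 2 by rewrite lt_def sqr_ge0 sqrf_eq0 Zr0.
  rewrite (_ : f r * (Im (Z r) * v) = Im (Z r) ^+ 2 * (Im z * v)); last by rewrite /f; ring.
  rewrite pmulr_rle0 // mulrDr; lra.
have dmon : f t <= f m.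
  apply: (@ler0_derive1_le_cc _ f m t) => //.
  - by move=> r /df [? D _]; exact: (@ex_derive _ _ _ _ _ _ _ D).
  - by move=> r /df [df' D df0]; rewrite derive1E (@derive_val _ _ _ _ _ _ _ D).
  - exact: continuous_subspaceT.
  - by rewrite in_itv /= lexx mt'.
  - by rewrite in_itv /= lexx mt'.
by have := le_trans dmon fm; rewrite ft; lra.
Qed.

End QuadraticCharacteristics.

(** * The negative real axis, on which characteristics stay real *)

Section NegativeAxis.
Context {R : realType}.
Variable phi : R -> R.
Hypothesis phi_cont : continuous phi.
Hypothesis phi_ge0 : forall x, 0 <= phi x.
Implicit Types (mu : bprob R) (w : R -> bprob R) (r t s k : R).

Local Notation Re := (@complex.Re R).
Local Notation Im := (@complex.Im R).
Local Notation stieltjes := (stieltjes phi).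
Local Notation separated := (separated phi).

Lemma cint_toC mu (h : R -> R) : cint mu (fun x => toC (h x)) = toC (\int[mu]_x h x)%R.
Proof. by apply: cplx_eq => //=; exact: Rintegral_prob_cst. Qed.

(** The value of [stieltjes mu] at [- r] with its sign reversed, which makes it positive. *)
Definition axis_transform mu r : R := (\int[mu]_x (r + phi x)^-1)%R.

Lemma axis_kernel_gt0 r x : 0 < r -> 0 < (r + phi x)^-1.
Proof. by move=> r0; rewrite invr_gt0 ltr_pwDl. Qed.

Lemma axis_kernel_cont r : 0 < r -> continuous (fun x => (r + phi x)^-1).
Proof.
move=> r0 x; apply: cvgV; first by rewrite gt_eqF // ltr_pwDl.
by apply: cvgD; [exact: cvg_cst|exact: phi_cont].
Qed.

Lemma axis_kernel_bounded r : 0 < r -> bounded_fun (fun x => (r + phi x)^-1).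
Proof.
move=> r0; exists r^-1; split; first exact: num_real.
move=> M rM x _ /=; rewrite ger0_norm; last by rewrite ltW // axis_kernel_gt0.
by apply: le_trans (ltW rM); rewrite lef_pV2 ?lerDl // posrE -invr_gt0 axis_kernel_gt0.
Qed.

Lemma axis_kernel_integrable mu r : 0 < r ->
  mu.-integrable setT (EFin \o (fun x => (r + phi x)^-1)).
Proof.
move=> r0; apply: cbounded_integrable; first exact: axis_kernel_cont.
exact: axis_kernel_bounded.
Qed.

Lemma axis_separated r : 0 < r -> separated r (toC (- r)).
Proof.
move=> r0 x; rewrite -toCB cn_toC ler0_norm; have := phi_ge0 x; lra.
Qed.

Lemma stieltjes_axis mu r : 0 < r ->
  stieltjes mu (toC (- r)) = toC (- axis_transform mu r).
Proof.
move=> r0; rewrite [RHS]toCN -[RHS]mulN1r -cint_toC -cintZ; last first.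
  have := ccbounded_resolvent phi_cont r0 (axis_separated r0).
  move=> /(ccboundedM (ccbounded_cst (-1))); congr ccbounded; apply/funext => x.
  by rewrite -toCB -toCV -toC1 -toCN -toCM; congr toC; rewrite -opprD invrN mulrNN mul1r.
by apply: eq_cint => x; rewrite -toCB -toCV -toC1 -toCN -toCM;
  congr toC; rewrite -opprD invrN mulN1r.
Qed.

Lemma axis_transform_gt0 mu r : 0 < r -> 0 < axis_transform mu r.
Proof.
move=> r0; apply: Rintegral_gt0; first exact: axis_kernel_cont.
  exact: axis_kernel_bounded.
by move=> x; exact: axis_kernel_gt0.
Qed.

Lemma axis_transform_decr mu r s : 0 < r -> r < s ->
  axis_transform mu s < axis_transform mu r.
Proof.
move=> r0 rs; have s0 := lt_trans r0 rs.
rewrite -subr_gt0 -RintegralB //; try exact: axis_kernel_integrable.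
have cbB : continuous (fun x => (r + phi x)^-1 - (s + phi x)^-1).
  by move=> x; apply: cvgB; exact: axis_kernel_cont.
have pos x : 0 < (r + phi x)^-1 - (s + phi x)^-1.
  by rewrite subr_gt0 ltf_pV2 ?ltrD2r // posrE -invr_gt0 axis_kernel_gt0.
apply: Rintegral_gt0 => //.
have [M [Mr hM]] := axis_kernel_bounded r0; exists M; split => // N MN x _ /=.
rewrite (ger0_norm (ltW (pos x))); apply: le_trans (hM N MN x I) => /=.
rewrite [leRHS](ger0_norm (ltW (axis_kernel_gt0 x r0))) lerBlDr lerDl.
by rewrite ltW // axis_kernel_gt0.
Qed.

Lemma mul_axis_transform_incr mu r s : 0 < r -> r <= s ->
  r * axis_transform mu r <= s * axis_transform mu s.
Proof.
move=> r0 rs; have s0 := lt_le_trans r0 rs.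
rewrite -RintegralZl //; last exact: axis_kernel_integrable.
rewrite -RintegralZl //; last exact: axis_kernel_integrable.
apply: le_Rintegral => //.
- exact: (integrableZl measurableT r (axis_kernel_integrable mu r0)).
- exact: (integrableZl measurableT s (axis_kernel_integrable mu s0)).
move=> x _; have px := phi_ge0 x.
rewrite ler_pdivrMr ?ltr_pwDl // mulrAC ler_pdivlMr ?ltr_pwDl //; nra.
Qed.

Lemma axis_transform_cvg w (F : set_system R) {FF : Filter F} t r : 0 < r ->
  weakly_cvg w F t -> axis_transform (w s) r @[s --> F] --> axis_transform (w t) r.
Proof.
move=> r0 wt; have := ccbounded_resolvent phi_cont r0 (axis_separated r0).
move=> /wt [H _].
have E mu : axis_transform mu r =
    - Re (cint mu (fun x => (toC (- r) - toC (phi x))^-1)).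
  by have := stieltjes_axis mu r0; rewrite /stieltjes => -> /=; rewrite opprK.
by rewrite E; under eq_fun do rewrite E; exact: cvgN.
Qed.

(** Real form of [quadratic_characteristic]. The time [t] may lie anywhere in the segment: the path
    is followed forwards to bound the atom and backwards to reach time 0. *)
Lemma axis_characteristic w k t r s0 s1 d :
  (forall t, 0 <= t -> weakly_cvg w (within `[0, +oo[ (nbhs t)) t) ->
  quadratic_pde phi w k [set y | exists2 u, 0 < u & y = toC (- u)] ->
  0 <= s0 -> 0 < r -> 0 < d ->
  let h := axis_transform (w t) r in
  let rho s := (1 - (s - t) * h) * ((1 - (s - t) * h) * r + k * (s - t)) in
  (forall s, s \in `[s0, s1] -> d <= rho s) -> t \in `[s0, s1] ->
  forall s, s \in `[s0, s1] ->
    [/\ char_factor (stieltjes (w t) (toC (- r))) t s = toC (1 - (s - t) * h),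
      char_point k (toC (- r)) (stieltjes (w t) (toC (- r))) t s = toC (- rho s) &
      (1 - (s - t) * h) * axis_transform (w s) (rho s) = h].
Proof.
move=> wc pde s00 r0 d0 h rho rhod ts s ss.
have fE u : char_factor (stieltjes (w t) (toC (- r))) t u = toC (1 - (u - t) * h).
  by rewrite /char_factor stieltjes_axis // -toC1 -toCM -toCB; congr toC; rewrite /h; ring.
have pE u : char_point k (toC (- r)) (stieltjes (w t) (toC (- r))) t u = toC (- rho u).
  by rewrite /char_point fE -!(toCM, toCD); congr toC; rewrite /rho; ring.
have rho0 u : u \in `[s0, s1] -> 0 < rho u by move=> /rhod; exact: lt_le_trans.
split => //.
have := @quadratic_characteristic R phi phi_cont w k _ (toC (- r)) t s0 s1 d wc pde s00 d0 _ _ ts s ss.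
rewrite fE pE (stieltjes_axis (w s) (rho0 s ss)) -toCM stieltjes_axis // => H.
suff : toC ((1 - (s - t) * h) * - axis_transform (w s) (rho s)) = toC (- h).
  by move=> /complexI; rewrite mulrN => /oppr_inj.
apply: H.
- move=> u us; rewrite -stieltjes_axis // pE; apply: (separatedW (rhod u us)).
  by apply: axis_separated; exact: rho0.
- move=> u us; exists (rho u); last by rewrite -stieltjes_axis // pE.
  by apply: rho0; exact: subset_itv_oo_cc.
Qed.

(* Write [H t r] for [axis_transform (w t) r].  If [r * H t r < k], the
   characteristic started at time [t] from a smaller
   [r1] reaches [0] at time [T = t + 1 / H t r1], with [r * H] tending to [k]
   along it; hence [r * H T r >= k] for all [r].  But [r * H < k] still holds at
   time [T] on the characteristic started from [r]. *)
Lemma axis_transform_atom w k t r :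
  (forall t, 0 <= t -> weakly_cvg w (within `[0, +oo[ (nbhs t)) t) ->
  quadratic_pde phi w k [set y | exists2 u, 0 < u & y = toC (- u)] ->
  0 <= t -> 0 < r -> k <= r * axis_transform (w t) r.
Proof.
move=> wc pde t0 r0; set h := axis_transform (w t) r.
have h0 : 0 < h by exact: axis_transform_gt0.
have [k0|k0] := leP k 0; first by rewrite (le_trans k0) // mulr_ge0 // ltW.
rewrite leNgt; apply/negP => hk.
(* Any point strictly between 0 and [r] would do: since [h < h1], the factor of the path from [r1]
   vanishes, at time [T], while that of the path from [r] is still positive. *)
pose r1 := r / 2; have r10 : 0 < r1 by rewrite divr_gt0.
pose h1 := axis_transform (w t) r1.
have h1h : h < h1 by apply: axis_transform_decr => //; rewrite /r1; lra.
have h10 := lt_trans h0 h1h.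
pose T := t + h1^-1.
have tT : t < T by rewrite ltrDl invr_gt0.
have T0 : 0 < T by exact: le_lt_trans tT.
have Th : (T - t) * h < 1 by rewrite /T addrAC subrr add0r mulrC ltr_pdivrMr // mul1r.
(* Forward propagation while the factor is positive: [e] is its least value on the segment, and
   [k > 0] keeps the path at least [e * (e * a)]. *)
have fwd (a b u : R) : 0 < a -> b = axis_transform (w t) a -> t <= u -> (u - t) * b < 1 ->
    let rho := (1 - (u - t) * b) * ((1 - (u - t) * b) * a + k * (u - t)) in
    0 < rho /\ (1 - (u - t) * b) * axis_transform (w u) rho = b.
  move=> a0 bE tu ub rho.
  have b0 : 0 < b by rewrite bE; exact: axis_transform_gt0.
  pose e := 1 - (u - t) * b; have e0 : 0 < e by rewrite subr_gt0.
  have low s : s \in `[t, u] -> e * (e * a) <=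
      (1 - (s - t) * b) * ((1 - (s - t) * b) * a + k * (s - t)).
    rewrite in_itv /= => /andP[ts su].
    have es : e <= 1 - (s - t) * b by rewrite lerD2l lerN2 ler_wpM2r ?(ltW b0) // lerD2r.
    apply: ler_pM => //; [exact: ltW|by rewrite mulr_ge0 // ltW|].
    rewrite (le_trans (y := (1 - (s - t) * b) * a)) ?ler_wpM2r ?(ltW a0) //.
    by rewrite lerDl mulr_ge0 ?(ltW k0) // subr_ge0.
  have ea0 : 0 < e * (e * a) by rewrite !mulr_gt0.
  split; first by apply: lt_le_trans ea0 (low u _); rewrite in_itv /= tu lexx.
  have := @axis_characteristic w k t a t u _ wc pde t0 a0 ea0.
  rewrite /= -bE => /(_ low) H.
  have tI : t \in `[t, u] by rewrite in_itv /= lexx tu.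
  have uI : u \in `[t, u] by rewrite in_itv /= lexx tu.
  by have [_ _] := H tI u uI.
have atT c : 0 < c -> k <= c * axis_transform (w T) c.
  move=> c0.
  (* The path is [q], and before [T] the value [G s] is [q s] times the transform of [w s] at [q s],
     by [fwd]. *)
  pose G s := h1 * ((1 - (s - t) * h1) * r1 + k * (s - t)).
  pose q s := (1 - (s - t) * h1) * ((1 - (s - t) * h1) * r1 + k * (s - t)).
  have sub1 : s - t @[s --> T^'-] --> T - t.
    by apply: cvgB; [exact: cvg_within_filter|exact: cvg_cst].
  have sub2 : 1 - (s - t) * h1 @[s --> T^'-] --> (0 : R).
    have -> : (0 : R) = 1 - (T - t) * h1.
      by rewrite /T addrAC subrr add0r mulVf ?subrr // gt_eqF.
    by apply: cvgB; [exact: cvg_cst|apply: cvgM => //; exact: cvg_cst].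
  have sub3 : (1 - (s - t) * h1) * r1 + k * (s - t) @[s --> T^'-] --> k / h1.
    have -> : k / h1 = 0 * r1 + k * (T - t).
      by rewrite mul0r add0r /T addrAC subrr add0r.
    apply: cvgD; first by apply: cvgM => //; exact: cvg_cst.
    by apply: cvgM => //; exact: cvg_cst.
  have GT : G s @[s --> T^'-] --> k.
    have -> : k = h1 * (k / h1) by rewrite mulrC divfK // gt_eqF.
    by apply: cvgM => //; exact: cvg_cst.
  have qT : q s @[s --> T^'-] --> (0 : R).
    rewrite -[X in _ --> X](mul0r (k / h1)); exact: cvgM.
  have wT : weakly_cvg w T^'- T.
    move=> f cf; have [f1 f2] := wc T (ltW T0) f cf.
    have sub : T^'- `=>` within `[0, +oo[ (nbhs T).
      move=> A; rewrite /within /= => HA; near=> s.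
      have : [set` `[0, +oo[] s -> A s by near: s; apply: cvg_within; exact: HA.
      apply; rewrite /= in_itv /= andbT; near: s; exact: nbhs_left_ge.
    by split; [move: f1|move: f2] => h'; apply: cvg_trans h'; exact: cvg_app.
  have cT : c * axis_transform (w s) c @[s --> T^'-] --> c * axis_transform (w T) c.
    by apply: cvgM; [exact: cvg_cst|exact: axis_transform_cvg].
  (* Near [T] the path is below [c], so [mul_axis_transform_incr] bounds [G s] by the product at
     [c]. *)
  apply: (ler_cvg_to GT cT).
  near=> s.
  have sT : s < T by near: s; exact: nbhs_left_lt.
  have ts : t <= s by near: s; exact: nbhs_left_ge.
  have sh1 : (s - t) * h1 < 1.
    by rewrite -ltr_pdivlMr // mul1r ltrBlDl.
  have [q0 qE] := fwd r1 h1 s r10 erefl ts sh1.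
  have qc : q s <= c.
    near: s; move/cvgrPdist_lt : qT => /(_ _ c0); apply: filterS => s.
    rewrite sub0r normrN => /ltW; exact: le_trans (ler_norm _).
  apply: le_trans (mul_axis_transform_incr (w s) q0 qc).
  rewrite [leRHS]mulrAC [X in _ <= X * _]qE //.
have [rho0 rhoE] := fwd r h T r0 erefl (ltW tT) Th.
have := atT _ rho0; rewrite mulrAC rhoE leNgt => /negP; apply.
have e0 : 0 < 1 - (T - t) * h by rewrite subr_gt0.
(* With [sg = T - t], the product on the path from [r] is the convex combination
   [(1 - sg h) * (r h) + (sg h) * k], still below [k]. *)
have := tT; rewrite -subr_gt0; move: (T - t) e0 => sg; nra.
Unshelve. all: end_near. Qed.

(** Off the real axis this is [quadratic_characteristic_Im]; on the negative axis the atom bound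
    keeps the backward path at distance at least [r] from 0. *)
Lemma quadratic_characteristic_slit w k t z :
  (forall t, 0 <= t -> weakly_cvg w (within `[0, +oo[ (nbhs t)) t) ->
  let slit := [set y : cplx R | Im y != 0 \/ Re y < 0] in
  quadratic_pde phi w k slit -> 0 <= t -> slit z ->
  let g := stieltjes (w t) z in
  slit (char_point k z g t 0) /\
  char_factor g t 0 * stieltjes (w 0) (char_point k z g t 0) = g.
Proof.
move=> wc slit pde t0 zslit g.
have t00 : 0 \in `[0, t] by rewrite in_itv /= lexx t0.
have [z0|z0] := eqVneq (Im z) 0; last first.
  have pdeI : quadratic_pde phi w k [set y | 0 < Im z * Im y].
    move=> s y s0 /= yz; apply: pde => //; left.
    by apply: contraTneq yz => ->; rewrite mulr0 ltxx.
  have [p1 p2] := quadratic_characteristic_Im phi_cont phi_ge0 wc z0 t0 pdeI t00.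
  split => //; left; apply: contraTneq p1 => ->; by rewrite mulr0 ltxx.
have rz : Re z < 0 by case: zslit; rewrite ?z0 ?eqxx.
have pdeN : quadratic_pde phi w k [set y | exists2 u, 0 < u & y = toC (- u)].
  by move=> s y s0 [u u0 ->]; apply: pde => //; right; rewrite /= oppr_lt0.
pose r := - Re z; have r0 : 0 < r by rewrite oppr_gt0.
have zE : z = toC (- r) by apply: cplx_eq; rewrite /= ?opprK.
have hk := axis_transform_atom wc pdeN t0 r0.
have h0 := axis_transform_gt0 (w t) r0.
have low s : s \in `[0, t] -> r <=
    (1 - (s - t) * axis_transform (w t) r) *
    ((1 - (s - t) * axis_transform (w t) r) * r + k * (s - t)).
  rewrite in_itv /= => /andP[s0 st].
  move: (axis_transform (w t) r) hk h0 => h hk h0.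
  have : 0 <= t - s by rewrite subr_ge0.
  rewrite -(opprB t s); move: (t - s) => u u0.
  have : 0 <= u * (r * h - k) by rewrite mulr_ge0 // subr_ge0.
  have : 0 <= u * h by rewrite mulr_ge0 // ltW.
  (* With [u = t - s] the path is the product of [1 + u h >= 1] and [r + u (r h - k) >= r], the
     latter by the atom bound. *)
  have E : (1 - - u * h) * ((1 - - u * h) * r + k * - u) =
    (1 + u * h) * (r + u * (r * h - k)) by ring.
  rewrite E; move: (u * h) (u * (r * h - k)) => a b a0 b0.
  have := mulr_ge0 a0 (ltW r0); have := mulr_ge0 a0 b0; lra.
have [] := @axis_characteristic w k t r 0 t r wc pdeN (lexx 0) r0 r0 low _ 0 t00.
  by rewrite in_itv /= lexx t0.
rewrite /g zE => -> -> H.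
set rho := (X in axis_transform (w 0) X) in H *.
have rho0 : 0 < rho by exact: lt_le_trans r0 (low 0 t00).
split; first by right; rewrite /= oppr_lt0.
by rewrite !stieltjes_axis // -toCM; congr toC; rewrite mulrN H.
Qed.

End NegativeAxis.

(** * Cauchy transforms of half-line and symmetric measures *)

Section MeasureTransfer.
Context {R : realType}.
Implicit Types (mu : bprob R) (f : R -> cplx R).

Local Notation Re := (@complex.Re R).
Local Notation Im := (@complex.Im R).

(** Change of variables along a map preserving [mu], used with the absolute value for half-line
    measures and with negation for symmetric ones. *)
Lemma eq_cint_pushforward mu (phi : R -> R) f : continuous phi ->
  (forall A : set (measurableTypeR R), measurable A -> mu (phi @^-1` A) = mu A) ->
  ccbounded f -> ccbounded (fun x => f (phi x)) ->
  cint mu f = cint mu (fun x => f (phi x)).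
Proof.
move=> pc pmu cf cfp.
have mphi : measurable_fun setT (phi : measurableTypeR R -> measurableTypeR R).
  exact: continuous_measurable_fun.
have key (h : R -> R) : continuous h -> bounded_fun h ->
    continuous (fun x => h (phi x)) -> bounded_fun (fun x => h (phi x)) ->
    (\int[mu]_x h x)%R = (\int[mu]_x h (phi x))%R.
  move=> hc hb hpc hpb; rewrite /Rintegral; congr fine.
  have mh : measurable_fun [set: measurableTypeR R] (EFin \o h).
    by case/integrableP : (cbounded_integrable mu hc hb).
  have := integral_pushforward (mu := mu) mphi mh
    (cbounded_integrable mu hpc hpb) measurableT.
  rewrite preimage_setT => <-.
  by apply: eq_measure_integral => A mA _; exact/esym/pmu.
have [rc rb] := ccbounded_Re cf; have [jc jb] := ccbounded_Im cf.
have [rpc rpb] := ccbounded_Re cfp; have [jpc jpb] := ccbounded_Im cfp.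
by apply: cplx_eq => /=; apply: key.
Qed.

Lemma half_line_norm mu : mu (~` `[0, +oo[) = 0%E ->
  forall A : set (measurableTypeR R), measurable A -> mu (Num.norm @^-1` A) = mu A.
Proof.
move=> mu0 A mA.
have mP : measurable ([set` `[0%R, +oo[] : set (measurableTypeR R)) by exact: measurable_itv.
have mnA : measurable (Num.norm @^-1` A : set (measurableTypeR R)).
  rewrite -[X in measurable X]setTI; apply: continuous_measurable_fun => //.
  exact: norm_continuous.
have null B : measurable B -> mu B = mu (B `&` `[0, +oo[).
  move=> mB; rewrite (measureDI mu mB mP) -[RHS]add0e; congr (_ + _)%E.
  apply/eqP; rewrite -measure_le0 -mu0 le_measure ?inE //.
    exact: measurableD.
  exact: (measurableC mP).
rewrite (null _ mA) (null _ mnA); congr (mu _); apply/seteqP.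
by split => x /= [Ax]; rewrite in_itv /= andbT => x0; split => //;
  move: Ax; rewrite ger0_norm.
Qed.

(** The definition gives invariance only for subsets of the positive half-line. When a set is cut
    into positive, negative and zero parts, negation exchanges the first two and fixes the third. *)
Lemma symmetric_opp mu : P0_sym mu ->
  forall A : set (measurableTypeR R), measurable A -> mu (-%R @^-1` A) = mu A.
Proof.
move=> [_ sym] A mA.
have mopp (B : set (measurableTypeR R)) :
    measurable B -> measurable (-%R @^-1` B : set (measurableTypeR R)).
  move=> mB; rewrite -[X in measurable X]setTI; apply: continuous_measurable_fun => //.
  exact: opp_continuous.
have imE (B : set R) : [set - x | x in B] = -%R @^-1` B.
  apply/seteqP; split => x /=; first by move=> [y By <-]; rewrite opprK.
  by move=> Bx; exists (- x) => //; rewrite opprK.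
pose P : set (measurableTypeR R) := [set` `]0%R, +oo[].
pose N : set (measurableTypeR R) := [set` `]-oo, 0%R[].
pose Z : set (measurableTypeR R) := [set 0].
have mP : measurable P by exact: measurable_itv.
have mN : measurable N by exact: measurable_itv.
have mZ : measurable Z by exact: measurable_set1.
have split3 (B : set (measurableTypeR R)) : measurable B ->
    mu B = (mu (B `&` P) + mu (B `&` N) + mu (B `&` Z))%E.
  move=> mB; rewrite -measureU; [|exact: measurableI|exact: measurableI|]; last first.
    apply/seteqP; split => // x /= [[_ xP] [_ xN]]; move: xP xN.
    by rewrite /P /N /= !in_itv /= andbT; lra.
  rewrite -measureU; [|by apply: measurableU; exact: measurableI|exact: measurableI|]; last first.
    apply/seteqP; split => // x /= [] /[swap] -[_ /= ->].
    by rewrite /P /N /= !in_itv /= ltxx => -[[]|[]].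
  congr (mu _); apply/seteqP; split => x; last by move=> [[[]|[]]|[]].
  move=> Bx; have [x0|x0|x0] := ltgtP x 0; [left; right|left; left|right]; split => //=.
  by rewrite /P /= in_itv /= x0.
have symP (B : set (measurableTypeR R)) : measurable B -> mu (-%R @^-1` (B `&` P)) = mu (B `&` P).
  by move=> mB; rewrite -imE -sym //; exact: measurableI.
rewrite (split3 _ mA) (split3 _ (mopp _ mA)).
have -> : (-%R @^-1` A) `&` P = -%R @^-1` (A `&` N).
  by apply/seteqP; split => x /= [? h]; split => //; move: h;
    rewrite /P /N /= !in_itv /= ?andbT ?oppr_lt0.
have -> : (-%R @^-1` A) `&` N = -%R @^-1` (A `&` P).
  by apply/seteqP; split => x /= [? h]; split => //; move: h;
    rewrite /P /N /= !in_itv /= ?andbT ?oppr_gt0.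
have -> : (-%R @^-1` A) `&` Z = A `&` Z.
  by apply/seteqP; split => x /= [Ax /= x0]; split => //=;
    move: x0; rewrite /Z /= => /eqP; rewrite ?oppr_eq0 => /eqP x0; move: Ax; rewrite x0 ?oppr0.
rewrite (symP _ mA).
have -> : mu (-%R @^-1` (A `&` N)) = mu (A `&` N).
  have -> : -%R @^-1` (A `&` N) = (-%R @^-1` A) `&` P.
    by apply/seteqP; split => x /= [? h]; split => //; move: h;
      rewrite /P /N /= !in_itv /= ?andbT ?oppr_lt0.
  rewrite -symP; last exact: mopp.
  congr (mu _); apply/seteqP; split => x /=; rewrite opprK => -[? h]; split => //; move: h;
    rewrite /P /N /= !in_itv /= ?andbT ?oppr_gt0 //.
by rewrite [X in (X + _)%E]addeC.
Qed.

End MeasureTransfer.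

(** * Cauchy transforms as resolvent integrals *)

Section CauchyTransforms.
Context {R : realType}.

Local Notation Re := (@complex.Re R).
Local Notation Im := (@complex.Im R).

Lemma cderiv_near (f g : R -> cplx R) s l :
  (\forall r \near s, f r = g r) -> cderiv f s l -> cderiv g s l.
Proof.
move=> fg [h1 h2]; split; [move: h1|move: h2];
  apply: near_eq_is_derive; by apply: filterS fg => r ->.
Qed.

Lemma near_pos (s : R) : 0 < s -> \forall r \near s, 0 <= r.
Proof. by move=> s0; near=> r; apply: ltW; near: r; exact: lt_nbhsr. Unshelve. all: end_near. Qed.

Lemma id_cont : continuous (id : R -> R).
Proof. by move=> x; exact: cvg_id. Qed.

Lemma norm_cont : continuous (Num.norm : R -> R).
Proof. exact: norm_continuous. Qed.

Lemma sq_cont : continuous (fun x : R => x ^+ 2).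
Proof. by move=> x; exact: exprn_continuous. Qed.

Lemma derive1_cauchy_transform (mu : bprob R) (z : cplx R) : Im z != 0 ->
  derive1 (@cauchy_transform R mu) z = - stieltjes2 id mu z z.
Proof.
move=> z0; apply: (@derive1_stieltjes R id id_cont mu `|Im z| z); first by rewrite normr_gt0.
exact: Im_separated.
Qed.

(** A half-line measure does not see negative [x], so the kernel may use the absolute value, which
    is nonnegative everywhere as the sign lemmas require. *)
Lemma half_line_stieltjes (mu : bprob R) (z : cplx R) : mu (~` `[0, +oo[) = 0%E -> Im z != 0 ->
  @cauchy_transform R mu z = stieltjes Num.norm mu z /\
  stieltjes2 id mu z z = stieltjes2 Num.norm mu z z.
Proof.
move=> mu0 z0; have d0 : 0 < `|Im z| by rewrite normr_gt0.
have s1 : separated id `|Im z| z by exact: Im_separated.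
have s2 : separated Num.norm `|Im z| z by exact: Im_separated.
split.
  apply: (eq_cint_pushforward norm_cont (half_line_norm mu0)
    (ccbounded_resolvent id_cont d0 s1) (ccbounded_resolvent norm_cont d0 s2)).
exact: (eq_cint_pushforward norm_cont (half_line_norm mu0)
  (ccbounded_resolvent2 id_cont d0 s1 s1) (ccbounded_resolvent2 norm_cont d0 s2 s2)).
Qed.

Lemma slit_separated (phi : R -> R) (y : cplx R) : (forall x, 0 <= phi x) ->
  Im y != 0 \/ Re y < 0 -> exists2 d, 0 < d & separated phi d y.
Proof.
move=> p0 [y0|y0].
  by exists `|Im y|; [rewrite normr_gt0|exact: Im_separated].
exists (- Re y); first by rewrite oppr_gt0.
move=> x; rewrite (le_trans _ (Re_le_cn _)) // cReD cReN /= ler0_norm;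
  have := p0 x; lra.
Qed.

Lemma sq_slit (z : cplx R) : 0 < Im z -> Im (z ^+ 2) != 0 \/ Re (z ^+ 2) < 0.
Proof.
move=> z0; rewrite expr2 !compE.
have [->|rz] := eqVneq (Re z) 0.
  by right; rewrite mul0r sub0r oppr_lt0 mulr_gt0.
by left; rewrite (mulrC (Im z)) -mulr2n mulrn_eq0 /= mulf_neq0 // gt_eqF.
Qed.

Lemma sqrt_up_sq (y : cplx R) : sqrt_up y ^+ 2 = y.
Proof. exact: sqrtCK. Qed.

(** The chosen root has nonnegative imaginary part; if it were 0, [y] would be the square of a real
    number, which the slit excludes. *)
Lemma Im_sqrt_up_gt0 (y : cplx R) : Im y != 0 \/ Re y < 0 -> 0 < Im (sqrt_up y).
Proof.
move=> ys; rewrite lt_def; apply/andP; split; last first.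
  have := @Im_rootC_ge0 (cplx R) 2 y isT.
  by rewrite -[X in _ <= X](complexIm (sqrt_up y)) ler0c.
apply/eqP => i0; have := sqrt_up_sq y; move: (sqrt_up y) i0 => v i0 vE.
move: ys; rewrite -vE expr2 !compE i0 !mulr0 mul0r addr0 subr0 eqxx => -[//|].
by rewrite ltNge -expr2 sqr_ge0.
Qed.

(** Averaging the kernel over [x] and [- x] gives [z / (z ^+ 2 - x ^+ 2)]. The second identity is
    the derivative of the first in [z]. *)
Lemma symmetric_stieltjes (mu : bprob R) (z : cplx R) : P0_sym mu -> 0 < Im z ->
  let sq := fun x : R => x ^+ 2 in
  cauchy_transform mu z = z * stieltjes sq mu (z ^+ 2) /\
  - stieltjes2 id mu z z = stieltjes sq mu (z ^+ 2) -
    2 * z ^+ 2 * stieltjes2 sq mu (z ^+ 2) (z ^+ 2).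
Proof.
move=> smu z0 sq; have d0 : 0 < `|Im z| by rewrite normr_gt0 gt_eqF.
have s1 : separated id `|Im z| z by exact: Im_separated.
have s2 : separated -%R `|Im z| z by exact: Im_separated.
have [e e0 s3] := slit_separated (fun x => sqr_ge0 x) (sq_slit z0).
have oc : continuous (-%R : R -> R) by exact: opp_continuous.
have b1 := ccbounded_resolvent id_cont d0 s1.
have b2 := ccbounded_resolvent oc d0 s2.
have b3 := ccbounded_resolvent sq_cont e0 s3.
have n1 x : z - toC x != 0 by exact: (separated_neq0 (phi := id) x d0 s1).
have n2 x : z + toC x != 0.
  by have := separated_neq0 x d0 s2; rewrite toCN opprK.
have sqE x : z ^+ 2 - toC (sq x) = (z - toC x) * (z + toC x).
  by rewrite /sq expr2 toCM; ring.
(* By symmetry, an integral depends only on the even part of its integrand. *)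
have half (f g : R -> cplx R) : ccbounded f -> ccbounded g ->
    ccbounded (fun x => f (- x)) -> (forall x, f x + f (- x) = 2 * g x) ->
    cint mu f = cint mu g.
  move=> cf cg cfo fg; apply: (mulfI (_ : (2 : cplx R) != 0)); first by rewrite pnatr_eq0.
  rewrite -(cintZ _ _ cg) mulr_natl mulr2n.
  rewrite {2}(eq_cint_pushforward oc (symmetric_opp smu) cf cfo) -cintD //.
  exact: eq_cint.
split.
  rewrite /stieltjes -cintZ //; apply: half => //.
    by apply: ccboundedM => //; exact: ccbounded_cst.
  by move=> x; rewrite sqE toCN opprK; field; rewrite n1 n2.
rewrite /stieltjes2 -[RHS]opprB; congr (- _).
have b33 := ccboundedM b3 b3.
have Z1 : ccbounded (fun x => 2 * z ^+ 2 * ((z ^+ 2 - toC (sq x))^-1 * (z ^+ 2 - toC (sq x))^-1)).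
  by apply: ccboundedM => //; exact: ccbounded_cst.
rewrite -cintZ // -[stieltjes _ _ _]mul1r -mulNr -cintZ // -cintD //; last first.
  by apply: ccboundedM => //; exact: ccbounded_cst.
apply: half.
- exact: ccboundedM.
- by apply: ccboundedD => //; apply: ccboundedM => //; exact: ccbounded_cst.
- exact: (ccboundedM b2 b2).
by move=> x; rewrite !sqE toCN opprK; field; rewrite n1 n2.
Qed.

End CauchyTransforms.

(** * The functional equations of the three processes *)

Theorem proposition3p1 (R : realType) (lam : R) (lam_ge0 : 0 <= lam) :
  [/\ (* (i) *)
      forall w : R -> bprob R,
        weakly_continuous_process (P0 setT) w ->
        (forall (t : R) (z : cplx R), 0 <= t -> upper_half_plane z ->
          exists2 dtG : cplx R,
            is_time_derive (fun s => cauchy_transform (w s) z) t dtG &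
            dtG + cauchy_transform (w t) z * derive1 (cauchy_transform (w t)) z = 0) ->
        forall (t : R) (z : cplx R), 0 <= t -> upper_half_plane z ->
          let G := cauchy_transform (w t) z in
          let z0 := z - toC t * G in
          upper_half_plane z0 /\ G = cauchy_transform (w 0) z0,
      (* (ii) *)
      forall m : R -> bprob R,
        weakly_continuous_process (P0 `[0, +oo[) m ->
        (forall (t : R) (z : cplx R), 0 <= t -> upper_half_plane z ->
          let G := cauchy_transform (m t) z in
          exists2 dtG : cplx R,
            is_time_derive (fun s => cauchy_transform (m s) z) t dtG &
            dtG + (2 * z * G - toC (1 - lam)) * derive1 (cauchy_transform (m t)) z
              + G ^+ 2 = 0) ->
        forall (t : R) (z : cplx R), 0 <= t -> upper_half_plane z ->
          let G := cauchy_transform (m t) z in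
          let z0 := (1 - toC t * G)
                    * (toC (1 - lam) * toC t + (1 - toC t * G) * z) in
          upper_half_plane z0 /\
          1 / G = toC t + 1 / cauchy_transform (m 0) z0
    & (* (iii) *)
      forall w : R -> bprob R,
        weakly_continuous_process (@P0_sym R) w ->
        (forall (t : R) (z : cplx R), 0 <= t -> upper_half_plane z ->
          let G := cauchy_transform (w t) z in
          exists2 dtG : cplx R,
            is_time_derive (fun s => cauchy_transform (w s) z) t dtG &
            dtG + (G - toC (1 - lam) / (2 * z)) * derive1 (cauchy_transform (w t)) z
              + toC (1 - lam) / (2 * z ^+ 2) * G = 0) ->
        forall (t : R) (z : cplx R), 0 <= t -> upper_half_plane z ->
          let G := cauchy_transform (w t) z in
          let z0 := sqrt_up ((1 - toC t / z * G)
                    * (toC (1 - lam) * toC t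
                       + (1 - toC t / z * G) * z ^+ 2)) in
          upper_half_plane z0 /\
          1 / G = toC t / z + z0 / (z * cauchy_transform (w 0) z0)].
Proof.
split.
- move=> w wp pde t z t0 z0 G.
  have wc := weakly_continuous_ccvg wp.
  have zn0 : complex.Im z != 0 by rewrite gt_eqF.
  have G0 : complex.Im G < 0.
    by have := Im_stieltjes_lt0 id_cont (w t) zn0; rewrite pmulr_rlt0.
  (* In (i) the value is constant along the straight line [Z], so that [p = A = 1] and [a = k = 0]
     below. *)
  pose Z s := z - toC (t - s) * G.
  have ImZ s : s \in `[0, t] -> complex.Im z <= complex.Im (Z s).
    rewrite in_itv /= => /andP[_ st]; rewrite /Z !compE /= mul0r addr0 lerDl oppr_ge0.
    by rewrite mulr_ge0_le0 ?subr_ge0 // ltW.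
  have Z0 : Z 0 = z - toC t * G by rewrite /Z subr0.
  have t00 : 0 \in `[0, t] by rewrite in_itv /= lexx t0.
  rewrite -Z0; split; first exact: lt_le_trans z0 (ImZ 0 t00).
  have dZ s : cderiv Z s G.
    apply: (cderiv_eq (cderivB (cderiv_cst z s)
      (cderivM (cderiv_toC_rev t s) (cderiv_cst G s)))); ring.
  have := @characteristic_eq R id id_cont w 0 t t (complex.Im z) (fun=> 1) Z (fun=> 1) 0 0 G.
  rewrite lexx => /(_ isT wc z0) H; symmetry; rewrite -[LHS]mul1r.
  apply: H => //.
  - move=> s /ImZ h; apply: Im_separated; exact: le_trans h (ler_norm _).
  - move=> s st L; have sI := subset_itv_oo_cc st.
    have s0 : 0 < s by move: st; rewrite in_itv /= => /andP[].
    have Zs0 : 0 < complex.Im (Z s) by exact: lt_le_trans z0 (ImZ s sI).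
    have [l dl] := pde s (Z s) (ltW s0) Zs0.
    rewrite derive1_cauchy_transform ?gt_eqF // => eq.
    exists l; first exact: time_derive_cderiv dl.
    by rewrite mul0r addr0 subr0 mul1r -eq mulrN.
  - by move=> s; rewrite mul0r; exact: cderiv_cst.
  - by move=> s; exists G => //; ring.
  - by move=> s; exact: ccvg_cst.
  - by rewrite in_itv /= lexx t0.
  - by rewrite mul1r /Z subrr mul0r subr0.
- move=> m mp pde t z t0 z0 G.
  have wc := weakly_continuous_ccvg mp.
  have half s : 0 <= s -> (m s) (~` `[0, +oo[) = 0%E by move=> /(mp.1 s) [].
  have zn0 : complex.Im z != 0 by rewrite gt_eqF.
  have t00 : 0 \in `[0, t] by rewrite in_itv /= lexx t0.
  have pdeN : quadratic_pde Num.norm m (1 - lam) [set y | 0 < complex.Im z * complex.Im y].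
    move=> s y s0 /=; rewrite pmulr_rgt0 // => y0.
    have yn0 : complex.Im y != 0 by rewrite gt_eqF.
    have [l dl] := pde s y (ltW s0) y0.
    have [E1 E2] := half_line_stieltjes (half s (ltW s0)) yn0.
    rewrite derive1_cauchy_transform // E1 E2 => eq.
    exists l; last by rewrite -eq; ring.
    apply: cderiv_near (time_derive_cderiv s0 dl).
    apply: filterS (near_pos s0) => r r0.
    by have [] := half_line_stieltjes (half r r0) yn0.
  have [E1 _] := half_line_stieltjes (half t t0) zn0.
  have := quadratic_characteristic_Im norm_cont (fun x => normr_ge0 x) wc zn0 t0 pdeN t00.
  rewrite -E1 -/G /char_point /char_factor subr0 => -[].
  set z1 := _ * (_ + _); rewrite pmulr_rgt0 // => z10 H; split => //.
  have [-> _] := half_line_stieltjes (half 0 (lexx 0)) (lt0r_neq0 z10).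
  have G0 : G != 0.
    apply: contraTneq (Im_stieltjes_lt0 norm_cont (m t) zn0).
    by rewrite -E1 -/G => ->; rewrite /= mulr0 ltxx.
  move: (stieltjes _ _ _) H => L H.
  have L0 : L != 0 by apply: contraNneq G0 => L0; rewrite -H L0 mulr0.
  have GE : G = L - toC t * G * L by rewrite -[LHS]H; ring.
  (* With [L] the initial transform at the foot of the path, multiplying by [G * L] turns the claim
     into [L = t G L + G], that is, [(1 - t G) L = G]. *)
  apply: (mulfI (mulf_neq0 G0 L0)).
  rewrite [LHS](_ : _ = L); last by field.
  rewrite [RHS](_ : _ = toC t * G * L + G); last by field.
  by rewrite {2}GE; ring.
- move=> w wp pde t z t0 z0 G.
  pose sq x : R := x ^+ 2.
  have wc := weakly_continuous_ccvg wp.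
  pose slit := [set y : cplx R | complex.Im y != 0 \/ complex.Re y < 0].
  have C_neq0 (y : cplx R) : 0 < complex.Im y -> y != 0.
    by move=> y0; apply: contraTneq y0 => ->; rewrite ltxx.
  have two0 : (2 : cplx R) != 0 by rewrite pnatr_eq0.
  have pdeS : quadratic_pde sq w (1 - lam) slit.
    (* The equation is taken at the root [v] of [y], with [G = v L], and divided by [v]: the terms
       in [(1 - lam) L] cancel and the equation of (ii) remains. *)
    move=> s y s0 ys; pose v := sqrt_up y.
    have v0 : 0 < complex.Im v by exact: Im_sqrt_up_gt0.
    have vE : v ^+ 2 = y by exact: sqrt_up_sq.
    have vn0 := C_neq0 _ v0.
    have [l dl] := pde s v (ltW s0) v0.
    have [E1 E2] := symmetric_stieltjes (wp.1 s (ltW s0)) v0.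
    rewrite derive1_cauchy_transform ?gt_eqF // E2 E1 vE -/sq => eq.
    exists (v^-1 * l).
      have D := cderivM (cderiv_cst v^-1 s) (time_derive_cderiv s0 dl).
      rewrite mul0r add0r in D.
      apply: cderiv_near D.
      apply: filterS (near_pos s0) => r r0.
      have [-> _] := symmetric_stieltjes (wp.1 r r0) v0; rewrite vE.
      by rewrite mulrA mulVf // mul1r -/sq.
    apply: (mulfI vn0); rewrite mulr0 -eq -vE; field.
    exact: vn0.
  have zs : slit (z ^+ 2) by exact: sq_slit.
  have [E1 _] := symmetric_stieltjes (wp.1 t t0) z0.
  have zn0 := C_neq0 _ z0.
  have := quadratic_characteristic_slit sq_cont (fun x => sqr_ge0 x) wc pdeS t0 zs.
  rewrite /char_point /char_factor subr0 -/sq.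
  set L := stieltjes _ _ _ in E1 *.
  have -> : 1 - toC t * L = 1 - toC t / z * G.
    by rewrite /G E1; field.
  set z1 := _ * (_ + _); move=> [s1 H]; pose z2 := sqrt_up z1.
  have z20 : 0 < complex.Im z2 by exact: Im_sqrt_up_gt0.
  split => //; rewrite -/z2.
  have [-> _] := symmetric_stieltjes (wp.1 0 (lexx 0)) z20.
  rewrite sqrt_up_sq -/sq.
  have G0 : G != 0.
    apply: contraTneq (Im_stieltjes_lt0 id_cont (w t) (lt0r_neq0 z0)) => G0.
    by rewrite -[stieltjes _ _ _]/G G0 /= mulr0 ltxx.
  have GE : G = z * L by rewrite /G E1.
  have L0 : L != 0 by apply: contraNneq G0 => L0; rewrite GE L0 mulr0.
  move: (stieltjes _ _ _) H => K H.
  have K0 : K != 0 by apply: contraNneq L0 => K0; rewrite -H K0 mulr0.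
  have z2n0 := C_neq0 _ z20.
  have LE : L = K - toC t * L * K by rewrite -[LHS]H GE; field.
  (* As in (ii), now multiplying by [L K z]; the root [z2] cancels because the initial transform at
     [z2] is [z2 K]. *)
  rewrite GE; apply: (mulfI (mulf_neq0 (mulf_neq0 L0 K0) zn0)).
  rewrite [LHS](_ : _ = K); last by field; rewrite ?L0 ?zn0.
  rewrite [RHS](_ : _ = toC t * L * K + L); last by field; rewrite ?L0 ?zn0 ?K0 ?z2n0.
  by rewrite {2}LE; ring.
Qed.
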